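(* There exist absolute constants $\lambda>0$ and $c>0$ (and absolute constants $c_1>0$, $C>0$) such that the following holds. Let $x\ge 2$ be real, let $\mathcal{P}$ be a subset of the primes $\le x$, and let $\mathcal{E}=\{p\le x:\ p \text{ prime},\ p\notin\mathcal{P}\}$. If there is some real $v>0$ with $v\le c\sqrt{\log x}$ and $$\sum_{\substack{p\in\mathcal{P}\\ x^{1/(ev)}<p\le x}}\frac1p\ \ge\ 1+\lambda ,$$ then $$\frac{\Psi(x;\mathcal{P})}{x}\ \ge\ \frac{c_1}{v^{Cv}}\ \prod_{p\in\mathcal{E}}\left(1-\frac1p\right).$$ (In the usual notation: $\Psi(x;\mathcal{P})/x\gg v^{-O(v)}\prod_{p\in\mathcal{E}}(1-1/p)$.)
   Context: $\Psi(x;\mathcal{P})$ denotes the number of positive integers $n\le x$ all of whose prime factors lie in $\mathcal{P}$ (so $n=1$ is counted). Here $e$ is the base of the natural logarithm, and $x^{1/(ev)}$ means $x$ to the power $1/(e\cdot v)$. *)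

(* Defs.v *)
From HB Require Import structures.
From mathcomp Require Import all_boot all_order all_algebra.
From mathcomp Require Import all_reals all_analysis.

Set Implicit Arguments.
Unset Strict Implicit.
Unset Printing Implicit Defensive.

Import Order.TTheory GRing.Theory Num.Theory.

Local Open Scope ring_scope.

(* For x >= 0, the naturals n <= x are those with n < (Num.truncn x).+1.
   [P.-nat n] holds iff n > 0 and every prime factor of n is in P, so n = 1 is
   counted. *)
Definition Psi (R : realType) (x : R) (P : nat_pred) : nat :=
  (\sum_(1 <= n < (Num.truncn x).+1 | P.-nat n) 1)%N.

Definition excluded_primes (R : realType) (x : R) (P : nat_pred) : nat_pred :=
  [pred p : nat | [&& prime p, p%:R <= x & p \notin P]].

(* Main.v *)
(* Write x = 2^L up to a factor 2, let U be an integer slightly above e v, put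
   l = L %/ U and let Q consist of the primes of P above 2^l.

   Small primes.  Splitting n into its part m built from primes <= 2^l and its
   part in <Q> gives Psi(x; P) >= sum_m Psi(x/m; Q) over m <= 2^l in <P>.
   Adding the excluded primes to P one at a time multiplies sum_m 1/m by at
   most the factors (1 - 1/p)^-1 and ends with a full harmonic sum, which is at
   least l/2.  So it suffices to show Psi(y; Q) >= U^-O(U) y / L for
   x^(1/2) <= y <= x.

   Large primes.  H(z) = L Psi(2^z; Q) / 2^z satisfies 2 U L H(z) >= sum_s
   H(z - s), where s runs over the set S of those s for which the dyadic block
   (2^(s-1), 2^s] contains at least 2^s / L primes of Q, and H >= 1 on S.  By
   Chebyshev's bound, the hypothesis makes sum_(s in S) 1/s large.  Split S into
   dyadic scales (2^i l, 2^(i+1) l].  If S meets a scale in not too few points,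
   then most points s of that scale act by translation on all the level sets
   {H >= U^(-11k)}, k = O(U), up to few exceptions: H(z - s) >= U^(-11k) implies
   H(z) >= U^(-11(k+1)).  Fix such an s in the first populated scale as modulus
   N and record the residues mod N attained by the level sets in successive
   windows [mN, (m+1)N).  These sets of residues grow with m, and each
   populated scale adds a fixed proportion of its own number of residues,
   because a set which gains little under translation by 1 and by the elements
   of B gains little under a positive proportion of all translations.  The
   scales together provide more than 32 N residues, so at some scale the
   attained residues and those of the scale overlap in every translate, and then
   every z in [L/2, L] lies in a level set with k = O(U). *)

Require Import Defs.
From HB Require Import structures.
From mathcomp Require Import all_boot all_order all_algebra.
From mathcomp Require Import all_reals all_analysis.
From mathcomp Require Import zify ring lra.

Set Implicit Arguments.
Unset Strict Implicit.
Unset Printing Implicit Defensive.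

Import Order.TTheory GRing.Theory Num.Theory.

Local Open Scope ring_scope.

(** * Translates in a cyclic group *)

Section CyclicSumsets.
Variables (G : finZmodType) (e : G).
Hypothesis gen_e : forall A : {set G},
  A != set0 -> {in A, forall x, x + e \in A} -> A = setT.

(** This is [A + B + {0, e}]. Unions of cosets of a proper subgroup can have a small plain sumset;
    the summand [{0, e}] removes this obstruction because [e] generates [G]. *)
Definition fuzzy_sum (A B : {set G}) : {set G} :=
  [set a + b | a in A, b in B] :|: [set a + b + e | a in A, b in B].

Lemma fuzzy_sumP (A B : {set G}) x :
  reflect (exists a b, [/\ a \in A, b \in B & x = a + b \/ x = a + b + e])
          (x \in fuzzy_sum A B).
Proof.
apply: (iffP setUP) => [[]/imset2P[a b aA bB ->]|[a [b [aA bB []->]]]].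
- by exists a, b; split=> //; left.
- by exists a, b; split=> //; right.
- by left; apply/imset2P; exists a b.
- by right; apply/imset2P; exists a b.
Qed.

Definition translate (A : {set G}) (t : G) : {set G} := [set a + t | a in A].

Lemma card_translate (A : {set G}) t : #|translate A t| = #|A|.
Proof. by apply: card_imset; apply: addIr. Qed.

Lemma mem_translate (A : {set G}) t x :
  (x \in translate A t) = (x - t \in A).
Proof.
apply/imsetP/idP => [[a aA ->]|xA]; first by rewrite addrK.
by exists (x - t); rewrite ?subrK.
Qed.

(* Dyson's e-transform: [A, B] become [A :|: (B + x)] and [B :&: (A - x)] with
   [x] in [A - B], until [A] is invariant under all differences of [B]; then
   an [x] in [A] with [x + e] outside [A] yields a whole new translate of
   [B]. *)
Lemma card_fuzzy_sum (A B : {set G}) : A != set0 -> B != set0 ->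
  (minn #|G| (#|A| + #|B|) <= #|fuzzy_sum A B|)%N.
Proof.
elim: {B}_.+1 {-2}B (ltnSn #|B|) A => // n IHn B ltBn A A0 B0.
have [a0 a0A] := set0Pn _ A0; have [b0 b0B] := set0Pn _ B0.
have [/forall_inP inv|] := boolP [forall a in A, forall b in B, forall c in B,
    a - b + c \in A]; last first.
  case/forall_inPn=> a aA /forall_inPn[b bB] /forall_inPn[c cB abc].
  set x := a - b; set A' := A :|: translate B x.
  set B' := B :&: translate A (- x).
  have bB' : b \in B'.
    by rewrite inE bB mem_translate opprK /x addrCA subrr addr0.
  have A'0 : A' != set0 by apply/set0Pn; exists a0; rewrite inE a0A.
  have B'0 : B' != set0 by apply/set0Pn; exists b.
  (* The element [c] leaves [B], since [c + x = a - b + c] is outside [A]. *)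
  have ltB' : (#|B'| < #|B|)%N.
    apply/proper_card/properP; split; first exact: subsetIl.
    exists c => //; rewrite inE cB mem_translate opprK addrC.
    exact: abc.
  have cardE : (#|A| + #|B| = #|A'| + #|B'|)%N.
    have -> : #|B'| = #|A :&: translate B x|.
      rewrite -(card_translate B' x); apply: eq_card => y.
      by rewrite mem_translate !inE !mem_translate opprK subrK andbC.
    by rewrite cardsUI card_translate.
  rewrite cardE; apply: leq_trans (IHn B' _ A' A'0 B'0) _.
    exact: leq_trans ltB' _.
  apply/subset_leq_card/subsetP => y /fuzzy_sumP[p [q [pA' qB' yE]]].
  apply/fuzzy_sumP; move: qB'; rewrite inE mem_translate opprK => /andP[qB qA].
  case/setUP: pA' => [pA|]; first by exists p, q.
  (* Exchanging the two summands keeps the sum, so the transform does not enlarge the fuzzy sum. *)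
  rewrite mem_translate => pB; exists (q + x), (p - x); split=> //.
  by rewrite addrACA subrr addr0 [q + p]addrC.
have invA a b c : a \in A -> b \in B -> c \in B -> a - b + c \in A.
  by move=> aA bB cB; have /forall_inP/(_ b bB)/forall_inP := inv a aA; apply.
have [/forall_inP clA|/forall_inPn[g gA gA']] :=
    boolP [forall a in A, a + e \in A].
  have AT := gen_e A0 clA; rewrite -cardsT -AT geq_min.
  apply/orP; left; rewrite -(card_translate A b0).
  apply/subset_leq_card/subsetP => y /imsetP[a aA ->].
  by apply/fuzzy_sumP; exists a, b0; split=> //; left.
rewrite geq_min; apply/orP; right.
(* A common element [y] would give [(y - b0) - (y - (g + e)) + b0 = g + e] in [A]. *)
have dis : translate A b0 :&: translate B (g + e) = set0.
  apply/setP => y; rewrite !inE !mem_translate; apply/negP => /andP[yA yB].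
  move: gA'; have := invA _ _ _ yA yB b0B.
  by rewrite opprB addrAC subrK addrC subrK => ->.
rewrite -(card_translate A b0) -(card_translate B (g + e)) -cardsUI dis.
rewrite cards0 addn0.
apply/subset_leq_card/subsetP => y /setUP[]; rewrite mem_translate => yM.
  by apply/fuzzy_sumP; exists (y - b0), b0; split=> //; left; rewrite subrK.
apply/fuzzy_sumP; exists g, (y - (g + e)); split=> //; right.
by rewrite addrAC addrC subrK.
Qed.

Definition gain (F : {set G}) (t : G) : nat :=
  #|translate F t :\: F|.

Lemma gainE F t : (gain F t + #|F :&: translate F t| = #|F|)%N.
Proof. by rewrite /gain addnC setIC cardsID card_translate. Qed.

(** A point of [F + s + t] outside [F] is either outside [F + t], which accounts for [gain F s]
    after a translation, or in [F + t] but outside [F]. *)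
Lemma gainD F (s t : G) : (gain F (s + t)%R <= gain F s + gain F t)%N.
Proof.
rewrite -[X in (_ <= X + _)%N](card_translate _ t) /gain.
apply: leq_trans (subset_leq_card _) (leq_card_setU _ _).
apply/subsetP => x; rewrite !inE !mem_translate opprD addrA [x - s - t]addrAC.
rewrite inE mem_translate => /andP[-> ->].
by case: (x - t \in F).
Qed.

Lemma gainC F t : gain (~: F) t = gain F t.
Proof.
have cardC : (#|F :\: translate F t| = gain F t)%N.
  by apply/eqP; rewrite -(eqn_add2l #|F :&: translate F t|) cardsID
     addnC gainE.
rewrite -cardC /gain; apply: eq_card => x.
by rewrite !inE !mem_translate !inE negbK andbC.
Qed.

(** Each fuzzy sum with [B] adds [#|B|] shifts and, by subadditivity, raises the gain by at most
    [2 * c]: once for an element of [B], once for [e]. *)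
Lemma gain_levels F B c : B != set0 ->
  (forall t, t \in B \/ t = e -> (gain F t <= c)%N) ->
  forall k, (minn #|G| (k.+1 * #|B|)
             <= #|[set t | gain F t <= k.+1.*2 * c]%N|)%N.
Proof.
move=> B0 Bc; elim=> [|k IHk].
  rewrite mul1n (leq_trans (geq_minr _ _)) //; apply: subset_leq_card.
  apply/subsetP => t tB; rewrite inE.
  by rewrite (leq_trans (Bc t _)) ?leq_pmull //; left.
set A := [set t | _] in IHk.
have [A0|A0] := eqVneq A set0.
  have [x xB] := set0Pn _ B0; move: IHk; rewrite A0 cards0.
  have B1 : (0 < #|B|)%N by apply/card_gt0P; exists x.
  have G1 : (0 < #|G|)%N by apply/card_gt0P; exists x.
  by rewrite leqNgt leq_min G1 muln_gt0 B1.
apply: leq_trans (leq_trans _ (card_fuzzy_sum A0 B0)) (subset_leq_card _).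
  rewrite mulSn; lia.
apply/subsetP => y /fuzzy_sumP[a [b [aA bB xE]]]; rewrite inE.
have gb := Bc b (or_introl bB); have ge := Bc e (or_intror erefl).
rewrite inE in aA; have gab := gainD F a b; have gabe := gainD F (a + b) e.
case: xE => ->; lia.
Qed.

(** Double counting: a pair [(x, x - t)] in [F * F] determines [t]. *)
Lemma sum_card_translateI (F T : {set G}) :
  (\sum_(t in T) #|F :&: translate F t| <= #|F| * #|F|)%N.
Proof.
have cardI (A : {set G}) : #|F :&: A| = (\sum_(x in F) (x \in A))%N.
  rewrite -sum1_card (eq_bigl (fun x => (x \in F) && (x \in A))).
    by rewrite big_mkcondr; apply: eq_bigr => x _; case: (x \in A).
  by move=> x; rewrite inE.
under eq_bigr do rewrite cardI.
rewrite exchange_big /= -sum_nat_const.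
apply: leq_sum => x xF.
have inj := inj_comp (addrI x) (@oppr_inj G).
rewrite -[X in (_ <= X)%N](card_imset (mem F) inj).
rewrite (eq_bigr (fun t : G => if (x - t)%R \in F then 1%N else 0%N));
  last first.
  by move=> t _; rewrite mem_translate; case: (_ \in _).
rewrite -big_mkcondr sum1_card; apply: subset_leq_card.
apply/subsetP => t; rewrite unfold_in => /andP[_ xtF].
by apply/imsetP; exists (x - t); rewrite //= opprB addrC subrK.
Qed.

(* Subadditivity of [gain F] propagates a small gain on [B] to all [k]-fold
   sums; these are numerous, while the gain is at least [#|F| / 2] on average
   over any set of size [2 * #|F|]. *)
Lemma exists_gain (F B : {set G}) : (0 < #|B|)%N ->
  (#|B| <= 2 * #|F|)%N -> (#|B| <= 2 * #|~: F|)%N ->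
  exists2 t, t \in B \/ t = e & (#|B| <= 16 * gain F t)%N.
Proof.
(* By [gainC], [F] may be replaced by its complement, so [2 * #|F| <= #|G|] may be assumed. *)
wlog FC : F / (#|F| <= #|~: F|)%N => [wlogF|] Bpos BF BFC.
  have [|/ltnW FC] := leqP #|F| #|~: F|; first by move/wlogF; apply.
  move: (wlogF (~: F)); rewrite setCK => /(_ FC Bpos BFC BF)[t tB gt].
  by exists t => //; rewrite -gainC.
have B0 : B != set0 by rewrite -card_gt0.
have cG := cardsC F.
have F0 : (0 < #|F|)%N by lia.
case: (pickP [pred t | ((t \in B) || (t == e)) && (#|B| <= 16 * gain F t)%N]).
  by move=> t /andP[/orP[tB|/eqP->] ?]; [exists t|exists e] => //; [left|right].
move=> no; exfalso.
have small t : t \in B \/ t = e -> (gain F t <= (#|B|.-1) %/ 16)%N.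
  move=> tBe; have := no t; rewrite /=.
  have -> /= : (t \in B) || (t == e).
    by case: tBe => [->|->]; rewrite ?eqxx ?orbT.
  move=> /negbT; rewrite -ltnNge => ?; rewrite leq_divRL //; lia.
set c := (_ %/ _)%N in small.
have c16 : (16 * c < #|B|)%N.
  by have := leq_trunc_div #|B|.-1 16; rewrite -/c; lia.
(* This [k] is the least with [k.+1 * #|B| > 2 * #|F|]. As [#|B| <= 2 * #|F|], also
   [k.+1 * #|B| <= 4 * #|F|]; with [16 * c < #|B|], all gains on [T] are then below [#|F| / 2],
   against the average. *)
have := gain_levels B0 small (2 * #|F| %/ #|B|).
set k := (2 * #|F| %/ #|B|)%N; set T := [set t | _] => lowT.
have k1 : (2 * #|F| <= k.+1 * #|B|)%N.
  by have := ltn_ceil (2 * #|F|)%N Bpos; rewrite -/k; lia.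
have k2 : (k * #|B| <= 2 * #|F|)%N by exact: leq_trunc_div.
clearbody k c.
have TF : (2 * #|F| <= #|T|)%N.
  by move: lowT; rewrite geq_min -cG => /orP[]; lia.
have sumT := sum_card_translateI F T.
have : (#|T| * (#|F| - k.+1.*2 * c) <= #|F| * #|F|)%N.
  apply: leq_trans sumT; rewrite -sum_nat_const; apply: leq_sum => t.
  by rewrite inE => ?; have := gainE F t; lia.
have [h|h] := leqP (2 * (k.+1.*2 * c)) (#|F|).-1; last first.
  move=> _; nia.
have : (2 * #|F| * (#|F| - k.+1.*2 * c) <= #|T| * (#|F| - k.+1.*2 * c))%N.
  by rewrite leq_mul2r TF orbT.
nia.
Qed.
End CyclicSumsets.

(** * Spreading of level sets *)

Lemma Zp_generated n (A : {set 'I_n.+2}) :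
  A != set0 -> {in A, forall x, x + 1 \in A} -> A = setT.
Proof.
move=> /set0Pn[x xA] clA; apply/setP => y; rewrite inE.
have clA' k : x + k%:R \in A.
  by elim: k => [|k IHk]; rewrite ?addr0 // -natr1 addrA clA.
by rewrite -(subrKC x y) -[y - x]natr_Zp clA'.
Qed.

Lemma sum_const_seq (V : nmodType) (I : Type) (s : seq I) (c : V) :
  \sum_(i <- s) c = c *+ size s.
Proof. by rewrite big_const_seq count_predT iter_addr_0. Qed.

Lemma ler_sum_subseq (R : numDomainType) (I : eqType) (s t : seq I)
    (F : I -> R) : uniq s -> uniq t -> {subset s <= t} ->
  (forall i, 0 <= F i) -> \sum_(i <- s) F i <= \sum_(i <- t) F i.
Proof.
move=> us ut st F0; rewrite (perm_big [seq i <- t | i \in s]) /=.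
  by rewrite big_filter big_mkcond; apply: ler_sum => i _; case: ifP.
apply: uniq_perm => //; first exact: filter_uniq.
by move=> i; rewrite mem_filter; case: (boolP (i \in s)) => //= /st ->.
Qed.

Section SpreadingOut.
Variables (R : realFieldType) (U L : nat) (H : nat -> R) (S : pred nat).
Hypotheses (U_ge100 : (100 <= U)%N) (U_le_L : (U <= L)%N).
Hypothesis H_succ : forall z, H z <= 2 * H z.+1.
Hypothesis H_conv : forall z, (z <= L)%N ->
  \sum_(0 <= s < z.+1 | S s) H (z - s)%N <= (2 * U * L)%:R * H z.
Hypothesis H_ge0 : forall z, 0 <= H z.
Hypothesis H_S : forall s, S s -> 1 <= H s.

Let U_pos : (0 < U)%N. Proof. exact: leq_trans U_ge100. Qed.
Let U_gt0 : 0 < U%:R :> R. Proof. by rewrite ltr0n; lia. Qed.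
Let L_gt0 : 0 < L%:R :> R. Proof. by rewrite ltr0n; lia. Qed.

(* The factor U^-11 is the price of one application of [H_conv] restricted to a
   proportion U^-7 of a set of at least L / (4 U^2) shifts, see [level_conv]. *)
Definition level (k z : nat) : bool := U%:R ^- (11 * k) <= H z.

Lemma level_mono k k' z : (k <= k')%N -> level k z -> level k' z.
Proof.
move=> kk'; apply: le_trans.
rewrite lef_pV2 ?posrE ?exprn_gt0 // ler_eXn2l ?leq_mul2l ?kk' ?orbT //.
by rewrite ltr1n; lia.
Qed.

Lemma level_succ k z : level k z -> level k.+1 z.+1.
Proof.
rewrite /level => kz; have := le_trans kz (H_succ z).
rewrite mulnS exprD invfM => h.
have : U%:R ^- 11 <= (2^-1 : R).
  rewrite lef_pV2 ?posrE ?exprn_gt0 // (@le_trans _ _ (U%:R ^+ 1)) //.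
    by rewrite expr1 ler_nat; lia.
  by rewrite ler_weXn2l // ler1n; lia.
have : 0 < (U%:R ^- (11 * k) : R) by rewrite invr_gt0 exprn_gt0.
by nra.
Qed.

(** At least [L / (4 U^9)] terms of [H_conv] are [U^(-11k)] or more, so [H z] is at least
    [U^(-11k) / (8 U^10)], and [8 <= U]. *)
Lemma level_conv (A : seq nat) k z : uniq A -> all S A ->
  (L <= 4 * U ^ 2 * size A)%N -> (z <= L)%N ->
  (size A <= U ^ 7 * count (fun s => (s <= z) && level k (z - s)) A)%N ->
  level k.+1 z.
Proof.
move=> uA SA LA zL; set c := count _ _ => cA.
have sumc : c%:R * U%:R ^- (11 * k) <= (2 * U * L)%:R * H z.
  apply: le_trans (H_conv zL); rewrite /c -size_filter.
  set A' := seq.filter _ A.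
  rewrite mulr_natl -sum_const_seq.
  apply: (@le_trans _ _ (\sum_(s <- A') H (z - s)%N)).
    rewrite big_seq [leRHS]big_seq; apply: ler_sum => s.
    by rewrite mem_filter => /andP[/andP[]].
  rewrite -[leRHS]big_filter; apply: ler_sum_subseq => //.
  - exact: filter_uniq.
  - by rewrite filter_uniq ?iota_uniq.
  - move=> s; rewrite !mem_filter mem_index_iota ltnS => /andP[/andP[-> _]].
    by move/(allP SA) ->.
have LR : L%:R <= 4 * U%:R ^+ 9 * c%:R :> R.
  have -> : 4 * U%:R ^+ 9 * c%:R = (4 * U ^ 2 * (U ^ 7 * c))%:R :> R.
    by rewrite !(natrM, natrX); ring.
  by rewrite ler_nat (leq_trans LA) // leq_mul.
rewrite /level mulnS exprD invfM ler_pdivrMl ?exprn_gt0 //.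
set w := U%:R ^- (11 * k) in sumc *.
have w0 : 0 < w by rewrite invr_gt0 exprn_gt0.
have : L%:R * w <= L%:R * (8 * U%:R ^+ 10 * H z).
  rewrite !natrM in sumc; have e9 : 0 <= 4 * U%:R ^+ 9 :> R.
    by rewrite mulr_ge0 ?exprn_ge0.
  by have := ler_wpM2l e9 sumc; nra.
rewrite ler_pM2l // => /le_trans; apply.
rewrite ler_wpM2r // [leRHS]exprS ler_wpM2r ?exprn_ge0 //.
by rewrite ler_nat; lia.
Qed.

(* [stable s] says that translation by [s] respects the level sets up to few
   exceptions, the pairs [(k, z)] in [jumps s]. *)
Definition jump k s z := [&& (s <= z)%N, level k (z - s) & ~~ level k.+1 z].

Definition jumps s : {set 'I_(6 * U) * 'I_L.+1} :=
  [set p : 'I_(6 * U) * 'I_L.+1 | jump p.1 s p.2].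

Definition stable s := (U ^ 7 * #|jumps s| <= 24 * U * L)%N.

(** Double counting of jumps: by [level_conv], each of the [6 U (L + 1)] pairs [(k, z)] is a jump
    for at most a proportion [U^-7] of [A], while an unstable shift has more than [24 U L / U^7]
    jumps. *)
Lemma half_stable (A : seq nat) : uniq A -> all S A ->
  (L <= 4 * U ^ 2 * size A)%N -> (size A <= 2 * count stable A)%N.
Proof.
move=> uA SA LA; pose c (p : 'I_(6 * U) * 'I_L.+1) :=
  count (fun s => jump p.1 s p.2) A.
have cA p : (U ^ 7 * c p <= size A)%N.
  case: p => k z; rewrite /c /=; have [up|nup] := boolP (level k.+1 z).
    rewrite (eq_count (a2 := pred0)) ?count_pred0 ?muln0 // => s.
    by rewrite /jump up !andbF.
  rewrite leqNgt; apply: contra nup => lt.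
  apply: level_conv uA SA LA _ _; first by rewrite -ltnS.
  apply: leq_trans (ltnW lt) _; rewrite leq_mul2l; apply/orP; right.
  by apply: sub_count => s /and3P[-> ->].
have sumE : (\sum_(s <- A) #|jumps s| = \sum_p c p)%N.
  under eq_bigr do rewrite -sum1_card big_mkcond /=.
  rewrite exchange_big; apply: eq_bigr => p _ /=.
  rewrite /c -sum1_count [RHS]big_mkcond; apply: eq_bigr => s _.
  by rewrite inE.
have sumA : (U ^ 7 * \sum_(s <- A) #|jumps s| <= 6 * U * L.+1 * size A)%N.
  rewrite sumE big_distrr /=.
  apply: (@leq_trans (\sum_(p : _ * _) size A)%N).
    by apply: leq_sum => p _; apply: cA.
  by rewrite sum_nat_const card_prod !card_ord.
have sumC : (count (predC stable) A * (24 * U * L)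
             <= U ^ 7 * \sum_(s <- A) #|jumps s|)%N.
  rewrite -sum1_count big_distrl big_distrr /= big_mkcond /=.
  apply: leq_sum => s _; case: ifP => //= ns.
  by rewrite mul1n ltnW // ltnNge.
have := count_predC stable A; move: sumA sumC; set T := (_ ^ _)%N.
set J := (\sum_(_ <- _) _)%N; clearbody T J.
move=> h1 h2 h3.
have : (24 * U * L * count (predC stable) A <= 12 * U * L * size A)%N by nia.
have -> : (24 * U * L = 12 * U * L * 2)%N by lia.
by rewrite -mulnA leq_pmul2l; [lia | rewrite !muln_gt0; lia].
Qed.

(** * Residues attained by level sets modulo a fixed shift *)

Section Modulus.
Variable n : nat.
Notation N := n.+2.
Hypothesis N_large : (L %/ U < N)%N.

Definition jump_residues s : {set 'I_N} := 
  [set inZp (nat_of_ord p.2) | p in jumps s].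

Lemma card_jump_residues s : (#|jump_residues s| <= #|jumps s|)%N.
Proof. exact: leq_imset_card. Qed.

(** If one of the [d] translations by [N] failed, the failing pair would be a jump of [N] in the
    residue class of [z]. *)
Lemma level_lift k z d : inZp z \notin jump_residues N -> level k z ->
  (z + d * N <= L)%N -> (k + d <= 6 * U)%N -> level (k + d) (z + d * N).
Proof.
move=> zJ kz; elim: d => [|d IHd]; first by rewrite mul0n !addn0.
move=> zL kU; have {}IHd := IHd ltac:(lia) ltac:(lia).
apply: contraNT zJ => nup; rewrite addnS in kU nup.
apply/imsetP; exists (Ordinal kU, Ordinal (zL : _ < L.+1)%N) => /=.
  rewrite inE /jump /= nup andbT mulSn addnCA leq_addr /=.
  by rewrite addKn.
by apply: val_inj; rewrite /= addnC modnMDl.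
Qed.

(* Removing the residues of the exceptions of [N] makes [attained] exactly
   monotone.  Passing to the next window costs one level; allowing two levels per
   window leaves room for a translation. *)
Definition attained m : {set 'I_N} :=
  [set x : 'I_N | level (2 * m) (x + m * N)] :\: jump_residues N.

Lemma window_bound m : (m.+1 * N <= L)%N -> (m < U)%N.
Proof.
move=> mL; have : (L < (L %/ U).+1 * U)%N by apply: ltn_ceil.
by nia.
Qed.

(** Lifting [z] to window [m] costs [m - z %/ N] levels; the bound on [k] keeps the total at most
    [2 * m]. *)
Lemma mem_attained k z m : level k z -> (z %/ N <= m)%N ->
  (k <= m + z %/ N)%N -> (m.+1 * N <= L)%N ->
  inZp z \notin jump_residues N -> inZp z \in attained m.
Proof.
move=> kz zm km mL zJ; rewrite !inE zJ /=.
have mU := window_bound mL.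
have zE : (z %% N + m * N = z + (m - z %/ N) * N)%N.
  rewrite {2}(divn_eq z N) mulnBl.
  have : (z %/ N * N <= m * N)%N by rewrite leq_mul2r zm orbT.
  by lia.
have zlt : (z %% N < N)%N by rewrite ltn_pmod.
rewrite zE; apply: (@level_mono (k + (m - z %/ N))); first by lia.
by apply: level_lift => //; [rewrite -zE; lia | lia].
Qed.

Lemma attained_mono m m' : (m <= m')%N -> (m'.+1 * N <= L)%N ->
  attained m \subset attained m'.
Proof.
move=> mm' m'L; apply/subsetP => x /[1!inE]/andP[xJ] /[1!inE] xm.
have xE : inZp (x + m * N) = x.
  by apply: val_inj; rewrite /= addnC modnMDl modn_small.
have xd : ((x + m * N) %/ N = m)%N.
  by rewrite addnC divnMDl // divn_small ?addn0.
by have := mem_attained xm; rewrite xE xd => /(_ m') -> //; lia.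
Qed.

(** The point [x + m * N + t] lies in window [m + t %/ N] or the next one, neither beyond [m'], so
    [mem_attained] applies at level [2 * m + 1]. [X] collects the residues at which translation by
    [t] may fail. *)
Lemma translate_attained t (X : {set 'I_N}) m m' :
  (m + t %/ N < m')%N -> (m'.+1 * N <= L)%N ->
  (forall x, x \in attained m -> inZp (x + m * N + t) \notin X ->
     level (2 * m).+1 (x + m * N + t)) ->
  translate (attained m) (inZp t) \subset
    attained m' :|: (jump_residues N :|: X).
Proof.
move=> mm' m'L tm; apply/subsetP => y /imsetP[x xm ->].
have -> : x + inZp t = inZp (x + m * N + t).
  apply: val_inj; rewrite /= addnAC.
  by rewrite modnDmr [in RHS]addnC modnMDl.
rewrite in_setU [in X in _ || X]in_setU; set z := (x + m * N + t)%N.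
case: (boolP (inZp z \in jump_residues N)) => [|zJ]; first by rewrite orbT.
case: (boolP (inZp z \in X)) => [|zX]; first by rewrite !orbT.
rewrite !orbF; have {tm}kz := tm x xm zX.
have tE := divn_eq t N; have tlt : (t %% N < N)%N by rewrite ltn_pmod.
have xlt := ltn_ord x.
have zlow : (m + t %/ N <= z %/ N)%N.
  by rewrite leq_divRL // mulnDl /z; clear -tE; lia.
have zup : (z %/ N < (m + t %/ N).+2)%N.
  by rewrite ltn_divLR // !mulSn mulnDl /z; clear -tE tlt xlt; lia.
by apply: mem_attained kz _ _ _ zJ; rewrite -/z //;
   move: (z %/ N)%N (t %/ N)%N zlow zup mm' {tE tlt} => q c; lia.
Qed.

Lemma attained_step (A : seq nat) m m' :
  all S A -> all stable A -> (0 < size A)%N ->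
  (m'.+1 * N <= L)%N -> (m < m')%N ->
  all (fun s => (m + s %/ N < m')%N) A ->
  let B := [set x in [seq inZp s : 'I_N | s <- A]] in
  (64 * #|jump_residues N| <= #|B|)%N ->
  all (fun s => 64 * #|jump_residues s| <= #|B|)%N A ->
  (#|B| <= 2 * #|~: attained m|)%N ->
  (32 * #|attained m| + #|B| <= 32 * #|attained m'|)%N.
Proof.
move=> SA stA A0 m'L mm' Am B BN BA BC.
have B0 : (0 < #|B|)%N.
  case: A A0 @B {SA stA Am BN BA BC} => // s A _; apply/card_gt0P.
  by exists (inZp s); rewrite inE /= mem_head.
have sub := attained_mono (ltnW mm') m'L.
pose b := #|B|; pose a := #|attained m|; pose a' := #|attained m'|.
pose j := #|jump_residues N|.
have bN : (64 * j <= b)%N by [].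
change ((32 * a + b <= 32 * a')%N).
(* If the attained set is small, [B] alone suffices: [H >= 1] on [S] puts its residues at level 0,
   and at most [b / 64] of them are lost. *)
have [BF|BF] := ltnP (2 * a) b.
  have /subset_leq_card BU : B \subset attained m' :|: jump_residues N.
    apply/subsetP => _ /[1!inE] /mapP[s sA ->]; rewrite in_setU.
    case: (boolP (inZp s \in jump_residues N)); rewrite ?orbT ?orbF //= => sJ.
    apply: (@mem_attained 0) sJ => //; last first.
      by rewrite (leq_trans (leq_addl m _)) // ltnW // (allP Am).
    by rewrite /level muln0 expr0 invr1 H_S // (allP SA).
  have : (b <= a' + j)%N := leq_trans BU (leq_card_setU _ _).
  by clear -BF bN; clearbody a a' b j; lia.
(* The gain is at least [b / 16]; the exceptions of [N] and of [t] cost at most [b / 64] each, which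
   leaves [b / 32]. *)
have [t tB gt] := exists_gain (@Zp_generated n) B0 BF BC.
have [X [XB Xt]] : exists X : {set 'I_N}, (64 * #|X| <= b)%N /\
    translate (attained m) t \subset attained m' :|: (jump_residues N :|: X).
  case: tB => [|->].
    rewrite inE => /mapP[s sA ->]; exists (jump_residues s).
    split; first exact: (allP BA).
    apply: translate_attained => //; first exact: (allP Am).
    move=> x; rewrite !inE => /andP[_ xm]; apply: contraNT => nup.
    have mU := window_bound m'L.
    have kU : (2 * m < 6 * U)%N by clear -mU mm'; lia.
    have zL : (x + m * N + s < L.+1)%N.
      have /= := allP Am s sA; have := divn_eq s N.
      have : (s %% N < N)%N by rewrite ltn_pmod.
      have := ltn_ord x; move: (s %/ N)%N (s %% N)%N => q r xlt rlt -> qm.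
      have : ((m + q).+2 * N <= m'.+1 * N)%N.
        by rewrite leq_mul2r !ltnS qm orbT.
      by rewrite !mulSn mulnDl; clear -xlt rlt m'L; lia.
    apply/imsetP; exists (Ordinal kU, Ordinal zL) => //.
    by rewrite inE /jump /= leq_addl addnK xm nup.
  (* For [t = 1] there are no exceptions, by [level_succ]. *)
  exists set0; split; first by rewrite cards0.
  have -> : (1 : 'I_N) = inZp 1 by apply: val_inj.
  apply: translate_attained => //; first by rewrite divn_small // addn0.
  by move=> x; rewrite !inE addn1 => /andP[_ xm] _; apply: level_succ.
pose g := gain (attained m) t; pose c := #|X|.
have {}gt : (b <= 16 * g)%N by [].
have {}XB : (64 * c <= b)%N by [].
have gU : (g <= #|attained m' :\: attained m| + (j + c))%N.
  have : translate (attained m) t :\: attained m \subset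
      (attained m' :\: attained m) :|: (jump_residues N :|: X).
    apply/subsetP => y /setDP[/(subsetP Xt)/setUP[ym' ym|yJ _]].
      by apply/setUP; left; apply/setDP.
    by apply/setUP; right.
  move/subset_leq_card/leq_trans; apply.
  apply: leq_trans (leq_card_setU _ _) _; rewrite leq_add2l.
  exact: leq_card_setU.
have aE : (a + #|attained m' :\: attained m| = a')%N.
  by rewrite /a' -[RHS](cardsID (attained m)) (setIidPr sub).
move: #|_ :\: _| gU aE => d gU aE.
by clear -gt XB gU aE bN; clearbody a a' b j g c; lia.
Qed.

(** More than half of the residues in [B] are carried into [attained m] by [x -> z - x]. Lifting
    from window [m] puts the corresponding [z - s] at level at most [2 * U], and [level_conv] adds
    one level. *)
Lemma level_of_attained (A : seq nat) m z : uniq A -> all S A ->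
  (L <= 4 * U ^ 2 * size A)%N -> (z <= L)%N ->
  all (fun s => (m * N + s <= z)%N) A ->
  let B := [set x in [seq inZp s : 'I_N | s <- A]] in
  (2 * #|~: attained m| < #|B|)%N -> (2 * size A <= U ^ 7 * #|B|)%N ->
  level (2 * U).+1 z.
Proof.
move=> uA SA LA zL Az B BC AB.
apply: (level_conv uA SA LA zL); set P := fun s : nat => _.
suff BP : (#|B| <= 2 * count P A)%N.
  rewrite -(leq_pmul2l (isT : 0 < 2)%N) (leq_trans AB) // mulnCA leq_mul2l.
  by rewrite BP orbT.
pose B' := [set x in B | inZp z - x \in attained m].
have cB' : (#|B| <= #|B'| + #|~: attained m|)%N.
  rewrite -(cardsID [set x | inZp z - x \in attained m] B) leq_add //.
    by apply/subset_leq_card/subsetP => x; rewrite !in_set.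
  rewrite -(card_imset _ (inj_comp (addrI (inZp z)) (@oppr_inj 'I_N))).
  apply/subset_leq_card/subsetP => _ /imsetP[x /setDP[_ xm] ->].
  by move: xm; rewrite in_setC in_set.
suff : (#|B'| <= count P A)%N.
  have {}BC : (2 * #|~: attained m| < #|B|)%N by [].
  clear -cB' BC.
  by move: #|B| #|B'| #|~: _| (count P A) cB' BC => a b c d; lia.
rewrite -size_filter -(size_map (@inZp n.+1)).
apply: leq_trans (card_size _); apply/subset_leq_card/subsetP => x.
case/setIdP; rewrite in_set => /mapP[s sA ->] xm.
apply/mapP; exists s => //; rewrite mem_filter sA andbT /P.
have /= sz := allP Az s sA.
have sz' : (s <= z)%N by rewrite (leq_trans _ sz) // leq_addl.
rewrite sz' /=; set y := (z - s)%N.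
have yE : inZp z - inZp s = inZp y :> 'I_N.
  apply/eqP; rewrite subr_eq; apply/eqP/val_inj.
  by rewrite /= modnDm subnK.
move: xm; rewrite yE => /setDP[ym yJ]; rewrite inE in ym.
have mq : (m <= y %/ N)%N by rewrite leq_divRL // /y leq_subRL // addnC.
have yD := divn_eq y N.
have yL : (y <= L)%N := leq_trans (leq_subr s z) zL.
have qU : (y %/ N < U)%N.
  have : (L < (L %/ U).+1 * U)%N by apply: ltn_ceil.
  have := leq_trunc_div y N; move: (y %/ N)%N (L %/ U)%N N_large => q l.
  by clear -yL; nia.
have E : (y %% N + m * N + (y %/ N - m) * N = y)%N.
  by rewrite -addnA -mulnDl subnKC // addnC -divn_eq.
rewrite -[X in level _ X]E.
apply: (@level_mono (2 * m + (y %/ N - m))).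
  by move: (y %/ N)%N mq qU => q; clear; lia.
apply: level_lift => //.
- rewrite (_ : inZp _ = inZp y) //; apply: val_inj.
  by rewrite /= addnC modnMDl modn_mod.
- by rewrite E.
- by move: (y %/ N)%N mq qU => q; clear; lia.
Qed.

End Modulus.

(** * Dyadic scales and growth of the attained residues *)

Notation l := (L %/ U)%N.

Definition scale i :=
  [seq s <- iota 0 L.+1 | S s && (2 ^ i * l < s <= 2 ^ i.+1 * l)%N].

(** The factor [2^5] leaves room for the windows attached to the scale below [L], and for a window
    plus a shift of the scale below [L / 2]. *)
Definition dense_scale i :=
  ((2 ^ (i + 5) * l <= L) && (2 ^ i * l <= U * size (scale i)))%N.

Definition steps i := [seq s <- scale i | stable s].

Let l_gt0 : (0 < l)%N. Proof. by rewrite divn_gt0. Qed.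

Let L_lt : (L < 2 * l * U)%N.
Proof.
have : (L < l.+1 * U)%N by apply: ltn_ceil.
by move: l l_gt0 => k k0; clear -k0; nia.
Qed.

Lemma scaleP i s : reflect
  [/\ S s, (2 ^ i * l < s)%N, (s <= 2 ^ i.+1 * l)%N & (s <= L)%N]
  (s \in scale i).
Proof.
rewrite mem_filter mem_iota /= add0n ltnS.
by apply: (iffP andP) => [[/and3P[]]|[? ? ? ?]]; split=> //; apply/and3P.
Qed.

Lemma scale_uniq i : uniq (scale i).
Proof. by rewrite filter_uniq ?iota_uniq. Qed.

Lemma scale_S i : all S (scale i).
Proof. by apply/allP => s /scaleP[]. Qed.

Lemma dense_size i : dense_scale i -> (L <= 2 * U ^ 2 * size (scale i))%N.
Proof.
case/andP=> _ h; apply: leq_trans (ltnW L_lt) _.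
have p2 : (0 < 2 ^ i)%N by rewrite expn_gt0.
have {}h := leq_trans (leq_pmull l p2) h.
by rewrite -!(mulnA 2) leq_mul2l -mulnn -mulnA mulnC leq_mul2l h !orbT.
Qed.

Lemma dense_steps i : dense_scale i -> (size (scale i) <= 2 * size (steps i))%N.
Proof.
move=> di; rewrite (size_filter stable); apply: half_stable.
- exact: scale_uniq.
- exact: scale_S.
- by apply: (leq_trans (dense_size di)); apply: leq_mul => //; apply: leq_mul.
Qed.


Lemma steps_sub i : {subset steps i <= scale i}.
Proof. exact/mem_subseq/filter_subseq. Qed.

Lemma dense_pow i k : dense_scale (i + k) -> (16 * 2 ^ k < U)%N.
Proof.
case/andP=> h _; have := leq_ltn_trans h L_lt.
have p2 : (0 < 2 ^ i)%N by rewrite expn_gt0.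
rewrite !expnD (_ : 2 ^ 5 = 32)%N //.
move: (2 ^ i)%N (2 ^ k)%N l l_gt0 p2 => a b c c0 a0 {}h.
have {}h : (2 * c * (16 * (a * b)) < 2 * c * U)%N.
  by apply: leq_ltn_trans h; clear; nia.
move: h; rewrite ltn_pmul2l; last by rewrite muln_gt0.
by apply: leq_ltn_trans; rewrite leq_mul2l leq_pmull.
Qed.

Section Scales.
Variables n i0 : nat.
Notation N := n.+2.
Hypothesis N_i0 : N \in steps i0.

Let N_bounds : (2 ^ i0 * l < N <= 2 ^ i0.+1 * l)%N.
Proof. by have /scaleP[_ -> ->] := steps_sub N_i0. Qed.

Let N_large : (l < N)%N.
Proof.
have /andP[+ _] := N_bounds; apply: leq_ltn_trans.
by rewrite leq_pmull // expn_gt0.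
Qed.

Let N_stable : stable N.
Proof. by move: N_i0; rewrite mem_filter => /andP[]. Qed.

Definition residues k : {set 'I_N} :=
  [set x in [seq inZp s : 'I_N | s <- steps (i0 + k)]].

Lemma quotient_bound k s : s \in scale (i0 + k) -> (s %/ N <= 2 * 2 ^ k)%N.
Proof.
case/scaleP=> _ _ sU _; have /andP[N1 _] := N_bounds.
rewrite -ltnS ltn_divLR //; apply: leq_ltn_trans sU _.
rewrite -addnS expnD mulnAC expnS.
by move: N1; move: (2 ^ i0 * l)%N (2 ^ k)%N => a q aN; clear -aN; nia.
Qed.

(** A shift is determined by its residue and its quotient by [N], and [quotient_bound] limits the
    quotients. *)
Lemma steps_residues k :
  (size (steps (i0 + k)) <= (2 * 2 ^ k).+1 * #|residues k|)%N.
Proof.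
set Q := (2 * 2 ^ k)%N.
pose f s : 'I_N * 'I_Q.+1 := (inZp s, inord (s %/ N)).
have uf : uniq [seq f s | s <- steps (i0 + k)].
  rewrite map_inj_in_uniq; first exact: (filter_uniq _ (scale_uniq _)).
  move=> s t /steps_sub sS /steps_sub tS [sm].
  move=> /(congr1 (@nat_of_ord _)); rewrite !inordK ?ltnS ?quotient_bound //.
  by move=> sd; rewrite (divn_eq s N) (divn_eq t N) sm sd.
have -> : (Q.+1 * #|residues k| = #|setX (residues k) [set: 'I_Q.+1]|)%N.
  by rewrite cardsX cardsT card_ord mulnC.
rewrite -(size_map f) -(card_uniqP uf).
apply/subset_leq_card/subsetP => _ /mapP[s sS ->].
by rewrite in_setX in_setT andbT in_set map_f.
Qed.

Lemma steps_residues_le k : dense_scale (i0 + k) ->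
  (size (steps (i0 + k)) <= U * #|residues k|)%N.
Proof.
move/dense_pow => kU; apply: leq_trans (steps_residues k) _.
by rewrite leq_mul2r orbC (leq_trans _ kU) // ltnS leq_mul2r orbT.
Qed.

(** With [e] jumps and [b] residues, stability gives [U^7 e <= 24 U L] and density gives
    [L <= 4 U^3 b]. Hence [U^3 e <= 96 b], and [64 * 96 <= 20^3 <= U^3]. *)
Lemma stable_residues k s : dense_scale (i0 + k) -> stable s ->
  (64 * #|jump_residues n s| <= #|residues k|)%N.
Proof.
move=> dk; rewrite /stable => st.
apply: leq_trans (_ : 64 * #|jumps s| <= _)%N.
  by rewrite leq_mul2l card_jump_residues.
have := steps_residues_le dk; have := dense_steps dk; have := dense_size dk.
move: st; move: #|jumps s| #|residues k| (size (scale _)) (size (steps _)).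
move=> e b m p st Lm mp pb.
have Lb : (L <= U ^ 3 * (4 * b))%N.
  apply: leq_trans Lm _; have := leq_trans mp (leq_mul (leqnn 2) pb).
  move/(leq_mul (leqnn (2 * U ^ 2)%N))/leq_trans; apply.
  by rewrite (expnS U 2) leq_eqVlt; apply/orP; left; apply/eqP; ring.
have : (U ^ 4 * (U ^ 3 * e) <= U ^ 4 * (96 * b))%N.
  rewrite mulnA -expnD; apply: leq_trans st _.
  apply: leq_trans (leq_mul (leqnn (24 * U)%N) Lb) _.
  by rewrite (expnS U 3) leq_eqVlt; apply/orP; left; apply/eqP; ring.
rewrite leq_pmul2l ?expn_gt0 ?U_pos // => h.
rewrite -(leq_pmul2l (isT : 0 < 96)%N) mulnA; apply: leq_trans h.
rewrite leq_mul2r orbC; apply/orP; left.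
apply: (@leq_trans (20 ^ 3)%N) => //.
by rewrite leq_exp2r // (leq_trans _ U_ge100).
Qed.

(** A shift of scale [i0 + k] advances by at most [2 * 2^k] windows, so from [window k] it stays
    before [window k.+1]. *)
Definition window k := (4 * 2 ^ k)%N.

Lemma window_fits k : (2 ^ (i0 + k + 5) * l <= L)%N ->
  ((window k.+1).+1 * N <= L)%N.
Proof.
move=> h; apply: leq_trans h; rewrite /window expnS !expnD.
have /andP[_ +] := N_bounds; rewrite expnS.
rewrite (_ : 2 ^ 5 = 32)%N //.
have : (0 < 2 ^ k)%N by rewrite expn_gt0.
move: (2 ^ i0)%N (2 ^ k)%N l => a b c b0 h.
apply: leq_trans (leq_mul (leqnn _) h) _; rewrite mulnA leq_mul2r orbC.
by clear -b0; nia.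
Qed.

Lemma attained_step_scale k : dense_scale (i0 + k) ->
  (#|residues k| <= 2 * #|~: attained n (window k)|)%N ->
  (32 * #|attained n (window k)| + #|residues k| <=
     32 * #|attained n (window k.+1)|)%N.
Proof.
move=> dk resk; apply: (@attained_step n N_large (steps (i0 + k))).
- by apply/allP => s /steps_sub; apply/allP/scale_S.
- exact: filter_all.
- have := dense_steps dk; have := dense_size dk; clear -U_ge100 U_le_L.
  case: (size (steps _)) => // + /[1!muln0].
  by case: (size _) => // /[1!muln0]; lia.
- by apply: window_fits; case/andP: dk.
- by rewrite /window expnS ltn_pmul2l // ltn_Pmull // expn_gt0.
- apply/allP => s /steps_sub /quotient_bound sk; rewrite /window expnS.
  by have : (0 < 2 ^ k)%N; [rewrite expn_gt0 | lia].
- exact: stable_residues.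
- apply/allP => s; rewrite mem_filter => /andP[st _].
  exact: stable_residues.
- exact: resk.
Qed.

Lemma level_of_residues k z : dense_scale (i0 + k) ->
  (2 * #|~: attained n (window k)| < #|residues k|)%N ->
  (L <= 2 * z)%N -> (z <= L)%N -> level (2 * U).+1 z.
Proof.
move=> dk resk Lz zL; pose A := steps (i0 + k).
apply: (@level_of_attained n N_large A (window k)) => //.
- exact: (filter_uniq _ (scale_uniq _)).
- by apply/allP => s /steps_sub; apply/allP/scale_S.
- apply: leq_trans (dense_size dk) _.
  apply: leq_trans (leq_mul (leqnn _) (dense_steps dk)) _.
  by rewrite mulnA leq_mul2r orbC [(_ * 2)%N]mulnC mulnA leqnn.
(* Here [window k * N + s <= 10 * 2^(i0 + k) * l], while [32 * 2^(i0 + k) * l <= L <= 2 * z]. *)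
- apply/allP => s /steps_sub /scaleP[_ _ sU _] /=.
  have /andP[_ NU] := N_bounds; have /andP[dL _] := dk.
  move: sU NU dL; rewrite /window -addnS !expnD !(expnS, expn0).
  move: (2 ^ i0)%N (2 ^ k)%N l Lz => a b c Lz sU NU dL.
  have := leq_mul (leqnn (4 * b)%N) NU.
  by clear -Lz sU dL; nia.
- apply: leq_trans (leq_mul (leqnn 2) (steps_residues_le dk)) _.
  rewrite mulnA leq_mul // (expnSr U 6) leq_mul //.
  apply: (@leq_trans (2 ^ 6)%N) => //.
  by rewrite leq_exp2r // (leq_trans _ U_ge100).
Qed.

(** The increments at dense scales telescope; elsewhere monotonicity of [attained] suffices. *)
Lemma sum_residues_le :
  (forall k, dense_scale (i0 + k) ->
     (#|residues k| <= 2 * #|~: attained n (window k)|)%N) ->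
  forall K, (2 ^ (i0 + K + 4) * l <= L)%N ->
  (\sum_(k < K | dense_scale (i0 + k)) #|residues k| <=
     32 * #|attained n (window K)|)%N.
Proof.
move=> grow; elim=> [|K IHK] KL; first by rewrite big_ord0.
have KL' : (2 ^ (i0 + K + 5) * l <= L)%N 
  by have -> : (i0 + K + 5 = i0 + K.+1 + 4)%N by clear; lia.
rewrite big_mkcond big_ord_recr -big_mkcond /=.
have {}IHK : (\sum_(k < K | dense_scale (i0 + k)) #|residues k| <=
     32 * #|attained n (window K)|)%N.
  apply: IHK; apply: leq_trans KL; rewrite leq_mul2r leq_exp2l //.
  by apply/orP; right; clear; lia.
case: ifP => [dK|_].
  apply: leq_trans (attained_step_scale dK (grow K dK)).
  by rewrite leq_add2r.
rewrite addn0 (leq_trans IHK) // leq_mul2l; apply/orP; right.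
apply/subset_leq_card/attained_mono => //; last exact: window_fits.
by rewrite /window leq_mul2l leq_exp2l ?leqnSn.
Qed.

(** With [a = 2^i0 * l] and [q = 2^k]: [N <= 2 a], each [s > a q], and the scale has at most [6 q]
    times as many shifts as residues. *)
Lemma sum_scale_le k : dense_scale (i0 + k) ->
  N%:R * \sum_(s <- scale (i0 + k)) s%:R^-1 <= (12 * #|residues k|)%:R :> R.
Proof.
move=> dk; pose a := (2 ^ i0 * l)%N; pose q := (2 ^ k)%N.
have a0 : (0 < a)%N by rewrite muln_gt0 expn_gt0.
have q0 : (0 < q)%N by rewrite expn_gt0.
have Na : (N <= 2 * a)%N by have /andP[_] := N_bounds; rewrite expnS -mulnA.
have aq0 : 0 < (a * q)%:R :> R by rewrite ltr0n muln_gt0 a0.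
have size_le : (size (scale (i0 + k)) <= 6 * q * #|residues k|)%N.
  apply: leq_trans (dense_steps dk) _.
  apply: leq_trans (leq_mul (leqnn 2) (steps_residues k)) _.
  by rewrite mulnA leq_mul2r orbC -/q; clear -q0; lia.
have sum_le : \sum_(s <- scale (i0 + k)) s%:R^-1 <=
    (a * q)%:R^-1 *+ size (scale (i0 + k)) :> R.
  rewrite -sum_const_seq big_seq [leRHS]big_seq; apply: ler_sum => s.
  case/scaleP=> _ sl _ _; rewrite expnD mulnAC in sl.
  rewrite lef_pV2 ?posrE // ?ler_nat ?(ltnW sl) // ltr0n.
  exact: leq_ltn_trans sl.
apply: le_trans (ler_wpM2l _ sum_le) _ => //.
rewrite -[_ *+ size _]mulr_natl mulrA ler_pdivrMr // -!natrM ler_nat.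
apply: leq_trans (leq_mul Na size_le) _.
by rewrite leq_eqVlt; apply/orP; left; apply/eqP; ring.
Qed.
End Scales.

Lemma scale_cover s : (0 < s <= L)%N -> S s -> (l < s)%N -> (32 * s <= L)%N ->
  exists2 i, (i < U)%N & (2 ^ (i + 5) * l <= L)%N /\ s \in scale i.
Proof.
(* The predecessor of [s] is used because scales are open on the left and closed on the right. *)
move=> /andP[s0 sL] Ss ls sL32; pose i := trunc_log 2 (s.-1 %/ l).
have q0 : (0 < s.-1 %/ l)%N by rewrite divn_gt0 // -ltnS prednK.
have := trunc_log_bounds (isT : 1 < 2)%N q0; rewrite -/i => /andP[].
rewrite leq_divRL // ltn_divLR // => i1 i2.
have iL : (2 ^ (i + 5) * l <= L)%N.
  apply: leq_trans sL32; rewrite expnD mulnAC mulnC leq_mul2l.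
  by rewrite (leq_trans i1) ?leq_pred.
exists i.
  have := leq_ltn_trans iL L_lt; rewrite -[in (2 * l)%N](mulnC l) -mulnA mulnC.
  rewrite ltn_pmul2l // expnD => h.
  have := ltn_expl i (isT : 1 < 2)%N; move: (2 ^ i)%N h => p; lia.
split=> //; apply/scaleP; split=> //; last by rewrite -(prednK s0).
by rewrite -(prednK s0) ltnS.
Qed.

(** Shifts above [L / 32] contribute at most [32 / L] each, hence at most 32 in all; every other
    shift lies in a scale. *)
Lemma sum_le_scales : (forall s, S s -> (l < s)%N) ->
  \sum_(1 <= s < L.+1 | S s) s%:R^-1 <=
    \sum_(i < U | (2 ^ (i + 5) * l <= L)%N) \sum_(s <- scale i) s%:R^-1
    + 32 :> R.
Proof.
move=> Sl.
pose f i s : R := if s \in scale i then s%:R^-1 else 0.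
have f0 i s : 0 <= f i s by rewrite /f; case: ifP => // _; rewrite invr_ge0.
have scaleE i : \sum_(s <- scale i) s%:R^-1 = \sum_(1 <= s < L.+1) f i s.
  rewrite /f -big_mkcond /= -[RHS]big_filter; apply: perm_big.
  apply: uniq_perm; rewrite ?filter_uniq ?iota_uniq ?scale_uniq //.
  move=> s; rewrite [RHS]mem_filter mem_index_iota.
  case: (boolP (s \in _)) => //= /scaleP[_ s1 _ sL].
  by rewrite ltnS sL (leq_ltn_trans _ s1).
under [X in _ <= X + _]eq_bigr do rewrite scaleE.
rewrite exchange_big /=.
have -> : 32 = \sum_(1 <= s < L.+1) 32 / L%:R :> R.
  rewrite sumr_const_nat subn1 -[RHS]mulr_natl /= mulrCA divff ?mulr1 //.
  by rewrite gt_eqF.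
rewrite -big_split /= big_mkcond big_nat_cond [leRHS]big_nat_cond.
apply: ler_sum => s /andP[/andP[s1 sL] _].
have sum0 : 0 <= \sum_(i < U | (2 ^ (i + 5) * l <= L)%N) f i s.
  by apply: sumr_ge0.
have c0 : 0 <= 32 / L%:R :> R by rewrite divr_ge0.
case: ifP => [Ss|_]; last exact: addr_ge0.
have sR : 0 < s%:R :> R by rewrite ltr0n.
have [sL32|sL32] := leqP (32 * s) L; last first.
  apply: ler_wpDl => //; rewrite ler_pdivlMr // mulrC ler_pdivrMr //.
  by rewrite -natrM ler_nat ltnW.
have s1L : (0 < s <= L)%N by rewrite s1 -ltnS.
have [i iU [iL si]] := scale_cover s1L Ss (Sl s Ss) sL32.
apply: ler_wpDr => //; rewrite (bigD1 (Ordinal iU)) //=.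
by rewrite {1}/f si lerDl sumr_ge0.
Qed.

(** Of the 420, shifts above [L / 32] take at most 32 and the at most [U] scales that are not dense
    at most [1 / U] each, leaving 387. If [z] missed the level, the residues of the dense scales
    would number at most [32 N], so their sum would be at most [12 * 32 = 384]. *)
Lemma level_upper_half z : (forall s, S s -> (l < s)%N) ->
  420 <= \sum_(1 <= s < L.+1 | S s) s%:R^-1 :> R ->
  (L <= 2 * z)%N -> (z <= L)%N -> level (2 * U).+1 z.
Proof.
move=> Sl S420 Lz zL; apply/negPn/negP => nz.
pose allowed i := (2 ^ (i + 5) * l <= L)%N.
pose f i : R := \sum_(s <- scale i) s%:R^-1.
have f0 i : 0 <= f i by apply: sumr_ge0 => s _; rewrite invr_ge0.
have thin i : allowed i -> ~~ dense_scale i -> f i <= U%:R^-1.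
  move=> ai; rewrite /dense_scale -/(allowed i) ai /= -ltnNge => lti.
  have a0 : (0 < 2 ^ i * l)%N by rewrite muln_gt0 expn_gt0.
  apply: (@le_trans _ _ ((2 ^ i * l)%:R^-1 *+ size (scale i))).
    rewrite -sum_const_seq /f big_seq [leRHS]big_seq; apply: ler_sum => s.
    case/scaleP=> _ sl _ _.
    rewrite lef_pV2 ?posrE ?ltr0n // ?ler_nat ?(ltnW sl) //.
    exact: leq_ltn_trans sl.
  rewrite -[leLHS]mulr_natl ler_pdivrMr ?ltr0n // mulrC ler_pdivlMr //.
  by rewrite mulrC -natrM ler_nat ltnW.
have dense_sum : 387 <= \sum_(i < U | dense_scale i) f i.
  have := le_trans S420 (sum_le_scales Sl).
  rewrite (bigID (fun i : 'I_U => dense_scale i)) /=.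
  set x := \sum_(i < U | _ && ~~ _) _.
  have : x <= 1.
    apply: (@le_trans _ _ (\sum_(i < U) U%:R^-1)).
      rewrite [leRHS](bigID (fun i : 'I_U => allowed i && ~~ dense_scale i)) /=.
      apply: ler_wpDr; first by apply: sumr_ge0 => i _; rewrite invr_ge0 ltW.
      by apply: ler_sum => i /andP[]; apply: thin.
    by rewrite sumr_const card_ord -[leLHS]mulr_natl divff // gt_eqF.
  rewrite (eq_bigl (fun i : 'I_U => dense_scale i)); last first.
    by move=> i; rewrite andbC; apply: andb_idr => /andP[].
  by move: x (\sum_(i < U | dense_scale i) _) => x y; lra.
have ex_dense : exists i, dense_scale i.
  have [/existsP[i di]|/existsPn nd] := boolP [exists i : 'I_U, dense_scale i].
    by exists i.
  by move: dense_sum; rewrite big_pred0 ?lern0 // => i; apply/negbTE.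
(* The modulus comes from the least dense scale, so that all dense scales are of the form
   [i0 + k]. *)
case: (ex_minnP ex_dense) => i0 di0 i0_min.
have size_pos : (0 < size (steps i0))%N.
  rewrite lt0n; apply/eqP => s0; have := dense_steps di0; rewrite s0 muln0.
  rewrite leqn0 => /eqP s1; have := dense_size di0; rewrite s1 muln0.
  by rewrite leqNgt (leq_trans U_pos).
have [N N_i0] : exists N, N \in steps i0.
  by case: (steps i0) size_pos => // N s _; exists N; rewrite mem_head.
have : (1 < N)%N.
  have /scaleP[_ + _ _] := steps_sub N_i0; apply: leq_ltn_trans.
  by rewrite muln_gt0 expn_gt0.
case: N N_i0 => [|[|n]] // N_i0 _.
have grow k : dense_scale (i0 + k) ->
    (#|residues n i0 k| <= 2 * #|~: attained n (window k)|)%N.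
  move=> dk; rewrite leqNgt; apply: contra nz => lt.
  exact: (level_of_residues N_i0 dk lt Lz zL).
have ex_top : exists K, ~~ allowed (i0 + K)%N.
  exists U; rewrite /allowed -ltnNge; apply: leq_trans L_lt _.
  rewrite mulnAC leq_mul2r; apply/orP; right.
  apply: (@leq_trans (2 * 2 ^ U)%N).
    by rewrite leq_mul2l /= ltnW // ltn_expl.
  by rewrite -expnS leq_exp2l //; clear; lia.
case: (ex_minnP ex_top) => K topK minK.
have KL : (2 ^ (i0 + K + 4) * l <= L)%N.
  case: K topK minK => [|K] topK minK.
    by case/andP: di0 => ai0 _; rewrite addn0 /allowed ai0 in topK.
  have aK : allowed (i0 + K)%N.
    by apply: contraT => /minK; rewrite ltnn.
  by rewrite (_ : i0 + K.+1 + 4 = i0 + K + 5)%N //; clear; lia.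
have sumD : \sum_(i < U | dense_scale i) f i <=
    \sum_(k < K | dense_scale (i0 + k)) f (i0 + k)%N.
  rewrite -(big_mkord (fun i => dense_scale i)).
  rewrite -(big_mkord (fun k => dense_scale (i0 + k)) (fun k => f (i0 + k)%N)).
  rewrite -big_filter -[leRHS]big_filter -(big_map (addn i0) xpredT f).
  apply: ler_sum_subseq => //.
  - by rewrite filter_uniq ?iota_uniq.
  - by rewrite map_inj_uniq ?filter_uniq ?iota_uniq //; apply: addnI.
  move=> i; rewrite mem_filter => /andP[di _]; apply/mapP.
  have i0i := i0_min i di; exists (i - i0)%N; last by rewrite subnKC.
  rewrite mem_filter subnKC // di mem_index_iota /= ltnNge.
  apply: contra topK => Ki; have /andP[ai _] := di.
  apply: leq_trans ai; rewrite leq_mul2r leq_exp2l //.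
  by apply/orP; right; rewrite leq_add2r -leq_subRL.
have card_le : (#|attained n (window K)| <= n.+2)%N.
  by rewrite (leq_trans (max_card _)) ?card_ord.
have sum_res := sum_residues_le N_i0 grow KL.
have := leq_trans sum_res (leq_mul (leqnn 32) card_le).
rewrite -(ler_nat R) natr_sum.
have sumN : n.+2%:R * \sum_(k < K | dense_scale (i0 + k)) f (i0 + k)%N <=
    12 * \sum_(k < K | dense_scale (i0 + k)) #|residues n i0 k|%:R.
  rewrite !mulr_sumr; apply: ler_sum => k dk.
  by rewrite -natrM; apply: sum_scale_le.
have N0 : 0 < n.+2%:R :> R by [].
move: sumN sumD; rewrite natrM; move: n.+2%:R N0 => N N0.
move: (\sum_(k < K | _) f _) (\sum_(k < K | _) _%:R) => x y h1 h2 h3.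
have : N * 387 <= N * x by rewrite ler_pM2l // (le_trans dense_sum).
by lra.
Qed.

End SpreadingOut.

(** * Counting integers by their prime factors *)

Lemma sum_multiples (V : nmodType) d X (F : nat -> V) : (0 < d)%N ->
  \sum_(1 <= m < (X %/ d).+1) F m =
  \sum_(1 <= n < X.+1 | (d %| n)%N) F (n %/ d)%N.
Proof.
move=> d0; rewrite -[RHS]big_filter.
rewrite [RHS](perm_big [seq (d * m)%N | m <- index_iota 1 (X %/ d).+1]) /=.
  by rewrite big_map; apply: eq_bigr => m _; rewrite mulKn.
apply: uniq_perm; first by rewrite filter_uniq ?iota_uniq.
  rewrite map_inj_uniq ?iota_uniq // => a b /eqP.
  by rewrite eqn_pmul2l // => /eqP.
move=> n; rewrite mem_filter mem_index_iota; apply/idP/mapP.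
  case/andP=> /dvdnP[m ->]; rewrite ltnS muln_gt0 => /andP[/andP[m0 _] mX].
  by exists m; rewrite 1?mulnC // mem_index_iota m0 ltnS leq_divRL.
case=> m; rewrite mem_index_iota ltnS leq_divRL // => /andP[m0 mX] ->.
by rewrite dvdn_mulr //= muln_gt0 d0 m0 ltnS mulnC.
Qed.

Lemma dyadic_split (V : nmodType) (F : nat -> V) z :
  \sum_(2 <= p < (2 ^ z).+1) F p =
  \sum_(j < z) \sum_((2 ^ j).+1 <= p < (2 ^ j.+1).+1) F p.
Proof.
elim: z => [|z IHz]; first by rewrite big_ord0 big_geq.
rewrite big_ord_recr /= -IHz -big_cat_nat //=; first by rewrite ltnS expn_gt0.
by rewrite ltnS leq_exp2l.
Qed.

Lemma prod_primes_dvd (s : seq nat) m : uniq s -> all prime s ->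
  all (fun p => p %| m)%N s -> (\prod_(p <- s) p %| m)%N.
Proof.
elim: s => [|p s IHs] /=; first by rewrite big_nil dvd1n.
move=> /andP[ps us] /andP[pp sp] /andP[pm sm]; rewrite big_cons Gauss_dvd.
  by rewrite pm IHs.
rewrite prime_coprime // Euclid_dvd_prod // big_has -all_predC.
apply/allP => q qs /=; rewrite dvdn_prime2 //; last exact: (allP sp).
by apply: contra ps => /eqP->.
Qed.

Lemma prod_primes_ge (s : seq nat) a : all (fun p => a <= p)%N s ->
  (a ^ size s <= \prod_(p <- s) p)%N.
Proof.
elim: s => [|p s IHs] /=; first by rewrite big_nil.
by case/andP=> ap sa; rewrite big_cons expnS leq_mul ?IHs.
Qed.

Lemma central_binomial_le n : ('C(n.*2, n) <= 2 ^ n.*2)%N.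
Proof.
rewrite -[2%N]/(1 + 1)%N expnDn.
have nn : (n < n.*2.+1)%N by rewrite ltnS -addnn leq_addr.
by rewrite (bigD1 (Ordinal nn)) //= !exp1n !muln1 leq_addr.
Qed.

Lemma prime_dvd_fact p n : prime p -> (p %| n`!)%N -> (p <= n)%N.
Proof.
move=> pp; elim: n => [|n IHn]; first by rewrite fact0 Euclid_dvd1.
rewrite factS Euclid_dvdM // => /orP[/dvdn_leq -> // | /IHn].
exact: leqW.
Qed.

(** Chebyshev's argument: for [n = 2^j], the primes in [(n, 2n]] exceed [n] and their product
    divides the central binomial coefficient, which is at most [2^(2n)]. *)
Lemma primes_in_cell j :
  (j * count prime (index_iota (2 ^ j).+1 (2 ^ j.+1).+1) <= 2 ^ j.+1)%N.
Proof.
set n := (2 ^ j)%N; have nE : (2 ^ j.+1 = n.*2)%N by rewrite expnS mul2n.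
rewrite nE; set I := index_iota _ _.
rewrite -(leq_exp2l _ _ (isT : 1 < 2)%N) expnM -/n -size_filter.
apply: leq_trans (central_binomial_le n).
apply: leq_trans (prod_primes_ge _) (dvdn_leq _ (prod_primes_dvd _ _ _)).
- apply/allP => p; rewrite mem_filter mem_index_iota => /and3P[_ np _].
  exact: ltnW.
- by rewrite bin_gt0 -addnn leq_addr.
- by rewrite filter_uniq ?iota_uniq.
- exact: filter_all.
apply/allP => p; rewrite mem_filter mem_index_iota ltnS => /and3P[pp np pn].
have n2 : (n <= n.*2)%N by rewrite -addnn leq_addr.
have : (p %| 'C(n.*2, n) * (n`! * (n.*2 - n)`!))%N.
  by rewrite bin_fact // dvdn_fact // prime_gt0.
rewrite -{2}addnn addnK !Euclid_dvdM // orbb => /orP[//|].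
by move/(prime_dvd_fact pp); rewrite leqNgt np.
Qed.

(** * Smooth counts and splitting off large primes *)

Definition smooth_count (X : nat) (P : nat_pred) : nat :=
  (\sum_(1 <= n < X.+1 | P.-nat n) 1)%N.

Lemma smooth_count_mono X Y P : (X <= Y)%N ->
  (smooth_count X P <= smooth_count Y P)%N.
Proof.
move=> XY; rewrite /smooth_count [leqRHS](big_cat_nat _ _ (n := X.+1)) //=.
exact: leq_addr.
Qed.

Lemma smooth_count_primes X (Q : nat_pred) :
  (forall p, p \in Q -> prime p) ->
  (\sum_(1 <= p < X.+1 | p \in Q) 1 <= smooth_count X Q)%N.
Proof.
move=> Qp; rewrite /smooth_count big_mkcond [leqRHS]big_mkcond.
apply: leq_sum => p _; case: ifP => // pQ.
by rewrite pnatE ?pQ // Qp.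
Qed.

Section Decomposition.
Variables (P Q : nat_pred) (l : nat).
Hypothesis PQ : forall p, p \in Q = (p \in P) && (2 ^ l < p)%N.
Hypothesis Pprime : forall p, p \in P -> prime p.

(** A number [n] arises from at most one [m]: all primes of [m] are at most [2^l], so [n %/ m] must
    be the [Q]-part of [n]. *)
Lemma smooth_count_split X :
  (\sum_(1 <= m < (2 ^ l).+1 | P.-nat m) smooth_count (X %/ m) Q
     <= smooth_count X P)%N.
Proof.
have smallQ' m : (0 < m)%N -> (m <= 2 ^ l)%N -> Q^'.-nat m.
  move=> m0 ml; apply/pnatP => // p pp pm; rewrite inE /= PQ negb_and -leqNgt.
  by rewrite (leq_trans (dvdn_leq m0 pm) ml) orbT.
have -> : (\sum_(1 <= m < (2 ^ l).+1 | P.-nat m) smooth_count (X %/ m) Q =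
  \sum_(1 <= m < (2 ^ l).+1 | P.-nat m)
     \sum_(1 <= n < X.+1) (m %| n) && Q.-nat (n %/ m))%N.
  apply: eq_bigr => m Pm; rewrite /smooth_count big_mkcond sum_multiples.
    rewrite [LHS]big_mkcond; apply: eq_bigr => n _.
    by case: (m %| n)%N; case: (Q.-nat _).
  by case/andP: Pm.
rewrite exchange_big /= /smooth_count [leqRHS]big_mkcond.
rewrite big_nat [leqRHS]big_nat; apply: leq_sum => n /andP[n1 nX].
case: ifPn => [Pn|nPn]; last first.
  rewrite big_nat_cond big1 // => m /andP[/andP[m1 mY] Pm].
  apply/eqP; rewrite eqb0; apply: contra nPn => /andP[mn Qnm].
  rewrite -(divnK mn) pnatM Pm andbT; apply: sub_in_pnat Qnm => p _.
  by rewrite PQ => /andP[].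
apply: (@leq_trans (\sum_(1 <= m < (2 ^ l).+1) (m == n %/ n`_Q))%N).
  rewrite big_mkcond big_nat [leqRHS]big_nat.
  apply: leq_sum => m /andP[m1 mY]; case: ifP => // Pm.
  case: (boolP (m %| n)%N) => //= mn; case: (boolP (Q.-nat _)) => //= Qnm.
  have -> : (n`_Q = n %/ m)%N.
    rewrite -{1}(divnK mn) partnM //; last by rewrite divn_gt0 // dvdn_leq.
    by rewrite part_pnat_id // part_p'nat ?muln1 // smallQ'.
  by rewrite divnA // mulKn // eqxx.
set c := (n %/ _)%N; rewrite (eq_bigr (fun m => if m == c then 1 else 0)%N).
  by rewrite -big_mkcond sum1_count count_uniq_mem ?iota_uniq ?leq_b1.
by move=> m _; case: (m == c).
Qed.

Lemma large_prime_divisors n L : (0 < n < 2 ^ L.+1)%N ->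
  (l * \sum_(1 <= p < n.+1 | (p \in Q) && (p %| n)%N) 1 <= L)%N.
Proof.
move=> /andP[n0 nL]; rewrite sum1_count -size_filter; set s := seq.filter _ _.
have sP p : p \in s -> [/\ prime p, (p %| n)%N & (2 ^ l < p)%N].
  rewrite mem_filter PQ => /andP[/andP[/andP[/Pprime ? ?] ?] _]; by split.
rewrite -ltnS -(ltn_exp2l _ _ (isT : 1 < 2)%N) expnM.
apply: leq_ltn_trans nL; apply: leq_trans (_ : \prod_(p <- s) p <= _)%N.
  by apply/prod_primes_ge/allP => p /sP[_ _ /ltnW].
apply: dvdn_leq => //; apply: prod_primes_dvd.
- by rewrite filter_uniq ?iota_uniq.
- by apply/allP => p /sP[].
- by apply/allP => p /sP[].
Qed.

(** Double counting of pairs [p %| n]: by [large_prime_divisors], [n] has at most [L / l] prime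
    divisors in [Q]. *)
Lemma smooth_count_primes_conv X L : (X < 2 ^ L.+1)%N ->
  (l * \sum_(1 <= p < X.+1 | p \in Q) smooth_count (X %/ p) Q
     <= L * smooth_count X Q)%N.
Proof.
move=> XL.
have -> : (\sum_(1 <= p < X.+1 | p \in Q) smooth_count (X %/ p) Q =
  \sum_(1 <= n < X.+1)
    \sum_(1 <= p < X.+1 | p \in Q) (p %| n) && Q.-nat (n %/ p))%N.
  rewrite exchange_big /=; apply: eq_bigr => p pQ.
  rewrite /smooth_count big_mkcond sum_multiples.
    rewrite [LHS]big_mkcond; apply: eq_bigr => n _.
    by case: (p %| n)%N; case: (Q.-nat _).
  by apply/prime_gt0/Pprime; move: pQ; rewrite PQ => /andP[].
rewrite /smooth_count !big_distrr /= [leqRHS]big_mkcond.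
rewrite big_nat [leqRHS]big_nat; apply: leq_sum => n /andP[n1 nX].
rewrite ltnS in nX; case: ifPn => [Qn|nQn]; last first.
  rewrite big1 ?muln0 // => p pQ.
  apply/eqP; rewrite eqb0; apply: contra nQn => /andP[pn Qnp].
  rewrite -(divnK pn) pnatM Qnp pnatE ?pQ //; apply: Pprime.
  by move: pQ; rewrite PQ => /andP[].
rewrite muln1; apply: (@leq_trans
  (l * \sum_(1 <= p < n.+1 | (p \in Q) && (p %| n)%N) 1)%N).
  rewrite leq_mul2l; apply/orP; right.
  rewrite (big_cat_nat _ _ (n := n.+1)) //= [X in (_ + X <= _)%N]big_nat_cond.
  rewrite [X in (_ + X)%N]big1 ?addn0.
    rewrite big_mkcondr /=; apply: leq_sum => p pQ.
    by case: (p %| n)%N; case: (Q.-nat _).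
  move=> p /andP[/andP[np _] pQ]; rewrite gtnNdvd //; exact: leq_ltn_trans np.
apply: large_prime_divisors; rewrite n1; exact: leq_ltn_trans XL.
Qed.
End Decomposition.

(** * Recursion for the large primes *)

Lemma harmonic_ge (R : realFieldType) z :
  z%:R / 2 <= \sum_(1 <= n < (2 ^ z).+1) n%:R^-1 :> R.
Proof.
rewrite big_ltn ?ltnS ?expn_gt0 // invr1 dyadic_split; apply: ler_wpDl => //.
have -> : z%:R / 2 = \sum_(j < z) 2^-1 :> R.
  by rewrite sumr_const card_ord -[RHS]mulr_natl.
apply: ler_sum => j _.
have -> : 2^-1 = \sum_((2 ^ j).+1 <= n < (2 ^ j.+1).+1) (2 ^ j.+1)%:R^-1 :> R.
  rewrite sumr_const_nat subSS expnS mul2n -addnn addnK addnn -mul2n.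
  rewrite -[RHS]mulr_natl natrM.
  by rewrite invfM mulrCA mulfV ?mulr1 // pnatr_eq0 -lt0n expn_gt0.
rewrite big_nat [leRHS]big_nat; apply: ler_sum => n /andP[n1 n2].
rewrite lef_pV2 ?posrE ?ltr0n ?expn_gt0 // ?ler_nat //.
exact: leq_trans n1.
Qed.

Definition recip_sum (R : realFieldType) (Y : nat) (P : nat_pred) : R :=
  \sum_(1 <= n < Y.+1 | P.-nat n) n%:R^-1.

(** In the enlarged sum, the multiples [p * m] contribute at most [1 / p] of the whole, and the
    other terms already occur for [P]. *)
Lemma recip_sum_add_prime (R : realFieldType) Y p (P : nat_pred) : prime p ->
  (1 - p%:R^-1) * recip_sum R Y [predU1 p & P] <= recip_sum R Y P.
Proof.
move=> pp; have p0 := prime_gt0 pp; set P' : nat_pred := [predU1 p & P].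
pose G n : R := if P'.-nat n then n%:R^-1 else 0.
have G0 n : 0 <= G n by rewrite /G; case: ifP; rewrite ?invr_ge0.
have SE X : recip_sum R X P' = \sum_(1 <= n < X.+1) G n.
  by rewrite /recip_sum big_mkcond.
have GM m : (0 < m)%N -> G (p * m)%N = p%:R^-1 * G m.
  move=> m0; rewrite /G pnatM pnatE // !inE eqxx /=.
  by case: ifP; rewrite ?mulr0 // natrM invfM.
have multiples : \sum_(1 <= n < Y.+1 | (p %| n)%N) G n <=
    p%:R^-1 * recip_sum R Y P'.
  have -> : \sum_(1 <= n < Y.+1 | (p %| n)%N) G n =
            \sum_(1 <= m < (Y %/ p).+1) p%:R^-1 * G m.
    rewrite sum_multiples //; rewrite big_nat_cond [RHS]big_nat_cond.
    apply: eq_bigr => n /andP[/andP[n1 _] pn].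
    have q0 : (0 < n %/ p)%N by rewrite divn_gt0 // dvdn_leq.
    by rewrite -(GM _ q0) mulnC divnK.
  rewrite -mulr_sumr ler_wpM2l ?invr_ge0 // SE.
  rewrite [leRHS](big_cat_nat _ _ (n := (Y %/ p).+1)) //= ?ltnS ?leq_div //.
  by rewrite lerDl sumr_ge0.
have others : \sum_(1 <= n < Y.+1 | ~~ (p %| n)%N) G n <= recip_sum R Y P.
  rewrite /recip_sum big_mkcond [leRHS]big_mkcond big_nat [leRHS]big_nat.
  apply: ler_sum => n /andP[n1 _]; rewrite /G.
  case: (boolP (p %| n)%N) => pn /=; first by case: ifP; rewrite ?invr_ge0.
  case: (boolP (P'.-nat n)) => [P'n|_]; last by case: ifP; rewrite ?invr_ge0.
  case: ifP => // /negP[]; apply/pnatP => // q qp qn.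
  have /(pnatP _ n1) /(_ q qp qn) := P'n; rewrite !inE => /predU1P[qE|//].
  by rewrite qE (negPf pn) in qn.
have := SE Y; rewrite (bigID (fun n => p %| n)%N) /=.
by move: multiples others; rewrite mulrBl mul1r; lra.
Qed.

(** The primes of [s] are moved into [P] one by one, until [P] contains every prime up to [Y] and
    its sum is the full harmonic sum. *)
Lemma recip_sum_sieve (R : realFieldType) Y (s : seq nat) (P : nat_pred) :
  all prime s -> (forall p, prime p -> (p <= Y)%N -> (p \in P) || (p \in s)) ->
  \prod_(p <- s) (1 - p%:R^-1) * \sum_(1 <= n < Y.+1) n%:R^-1
    <= recip_sum R Y P.
Proof.
elim: s P => [|p s IHs] P /=.
  move=> _ Pall; rewrite big_nil mul1r /recip_sum [leRHS]big_mkcond.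
  rewrite big_nat [leRHS]big_nat; apply: ler_sum => n /andP[n1 nY].
  case: ifP => // /negP[]; apply/pnatP => // p pp pn.
  by have := Pall p pp (leq_trans (dvdn_leq n1 pn) nY); rewrite orbF.
case/andP=> pp sp Pall; rewrite big_cons -mulrA.
apply: le_trans (recip_sum_add_prime R Y P pp).
rewrite ler_wpM2l //.
  by rewrite subr_ge0 invf_le1 ?ler1n ?ltr0n ?prime_gt0.
apply: IHs => // q qp qY; have := Pall q qp qY.
by rewrite !inE => /or3P[] ->; rewrite ?orbT.
Qed.

Section Cells.
Variables (R : realFieldType) (P Q : nat_pred) (U L : nat).
Notation l := (L %/ U)%N.
Hypotheses (U_ge100 : (100 <= U)%N) (U_le_L : (U <= L)%N).
Hypothesis PQ : forall p, p \in Q = (p \in P) && (2 ^ l < p)%N.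
Hypothesis Pprime : forall p, p \in P -> prime p.

Definition cell j : nat :=
  (\sum_((2 ^ j).+1 <= p < (2 ^ j.+1).+1 | p \in Q) 1)%N.

Let Qprime p : p \in Q -> prime p.
Proof. by rewrite PQ => /andP[/Pprime]. Qed.

Let l_gt0 : (0 < l)%N.
Proof. by rewrite divn_gt0 // (leq_trans _ U_ge100). Qed.

Lemma cell_le j : (j * cell j <= 2 ^ j.+1)%N.
Proof.
apply: leq_trans (primes_in_cell j); rewrite leq_mul2l; apply/orP; right.
by rewrite /cell sum1_count; apply: sub_count => p /Qprime.
Qed.

Lemma cell_small j : (j < l)%N -> cell j = 0%N.
Proof.
move=> jl; rewrite /cell big_nat_cond big_pred0 // => p; rewrite PQ.
apply/negP => /andP[/andP[_ pj] /andP[_]]; rewrite ltnNge => /negP; apply.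
by rewrite ltnS in pj; rewrite (leq_trans pj) // leq_exp2l.
Qed.

Lemma sum_cells_conv z :
  (\sum_(j < z) cell j * smooth_count (2 ^ (z - j.+1)) Q <=
   \sum_(1 <= p < (2 ^ z).+1 | p \in Q) smooth_count (2 ^ z %/ p) Q)%N.
Proof.
rewrite [leqRHS]big_ltn_cond ?ltnS ?expn_gt0 //.
rewrite ifN; last by apply/negP => /Qprime.
rewrite [leqRHS]big_mkcond dyadic_split; apply: leq_sum => j _.
rewrite /cell big_distrl -big_mkcond /= big_nat_cond [leqRHS]big_nat_cond.
apply: leq_sum => p /andP[/andP[p1 p2] _]; rewrite mul1n.
apply: smooth_count_mono; rewrite leq_divRL; last exact: leq_trans p1.
rewrite ltnS in p2; apply: leq_trans (leq_mul (leqnn _) p2) _.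
by rewrite -expnD subnK.
Qed.

Definition density z : R := L%:R * (smooth_count (2 ^ z) Q)%:R / (2 ^ z)%:R.

(** Indexed by the upper exponent of the block: dividing [2^z] by one of its primes leaves at least
    [2^(z - s)]. *)
Definition rich s := (l < s)%N && (2 ^ s <= L * cell s.-1)%N.

(** The double count over large primes, restricted to rich cells, each of which weighs at least
    [1 / L]; the factor [2 U] bounds [L / l]. *)
Lemma density_conv z : (z <= L)%N ->
  \sum_(0 <= s < z.+1 | rich s) density (z - s)%N <= (2 * U * L)%:R * density z.
Proof.
move=> zL; set psi := fun y => smooth_count (2 ^ y) Q.
have psiE : (\sum_(j < z) cell j * psi (z - j.+1) <= 2 * U * psi z)%N.
  rewrite -(leq_pmul2l l_gt0).
  apply: leq_trans (leq_mul (leqnn _) (sum_cells_conv z)) _.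
  apply: leq_trans (smooth_count_primes_conv PQ Pprime (L := L) _) _.
    by rewrite ltn_exp2l.
  rewrite !mulnA leq_mul2r; apply/orP; right.
  have : (L < l.+1 * U)%N by rewrite ltn_ceil // (leq_trans _ U_ge100).
  by move: l l_gt0 => k; clear; nia.
have p2 y : 0 < (2 ^ y)%:R :> R by rewrite ltr0n expn_gt0.
rewrite big_ltn_cond //= big_add1 /= big_mkord.
have -> : (2 * U * L)%:R * density z =
    (L * L)%:R / (2 ^ z)%:R * (2 * U * psi z)%:R.
  by rewrite /density !natrM; field; rewrite gt_eqF.
have psiR : (\sum_(j < z) cell j * psi (z - j.+1))%:R <=
    (2 * U * psi z)%:R :> R by rewrite ler_nat.
apply: le_trans (ler_wpM2l _ psiR); last by rewrite divr_ge0.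
rewrite natr_sum mulr_sumr big_mkcond /=; apply: ler_sum => j _.
case: ifP => [/andP[_ rj]|_]; last by rewrite mulr_ge0 ?divr_ge0.
rewrite /density -/(psi _) /= in rj *.
have zE : (2 ^ z = 2 ^ (z - j.+1) * 2 ^ j.+1)%N by rewrite -expnD subnK.
have rjR : (2 ^ j.+1)%:R <= L%:R * (cell j)%:R :> R by rewrite -natrM ler_nat.
rewrite zE !natrM.
rewrite ler_pdivrMr //.
have -> : L%:R * L%:R / ((2 ^ (z - j.+1))%:R * (2 ^ j.+1)%:R) *
    ((cell j)%:R * (psi (z - j.+1)%N)%:R) * (2 ^ (z - j.+1))%:R
  = L%:R * (psi (z - j.+1)%N)%:R * (L%:R * (cell j)%:R / (2 ^ j.+1)%:R) :> R.
  by field; rewrite !gt_eqF.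
by rewrite -[leLHS]mulr1 ler_wpM2l ?mulr_ge0 // ler_pdivlMr // mul1r.
Qed.

Lemma density_succ z : density z <= 2 * density z.+1.
Proof.
have p2 y : 0 < (2 ^ y)%:R :> R by rewrite ltr0n expn_gt0.
have -> : 2 * density z.+1 = L%:R * (smooth_count (2 ^ z.+1) Q)%:R / (2 ^ z)%:R.
  by rewrite /density [X in _ / X%:R]expnS natrM; field; rewrite gt_eqF.
rewrite /density ler_wpM2r ?invr_ge0 // ler_wpM2l // ler_nat.
by rewrite smooth_count_mono // leq_exp2l.
Qed.

Lemma density_ge0 z : 0 <= density z.
Proof. by rewrite /density divr_ge0 ?mulr_ge0. Qed.

(** The primes of the cell are themselves counted by [smooth_count]. *)
Lemma density_rich s : rich s -> 1 <= density s.
Proof.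
case: s => [|s]; first by rewrite /rich ltn0.
case/andP=> _ /= rs; rewrite /density ler_pdivlMr ?ltr0n ?expn_gt0 // mul1r.
rewrite -natrM ler_nat (leq_trans rs) // leq_mul2l; apply/orP; right.
apply: leq_trans (smooth_count_primes _ Qprime).
rewrite /cell [leqRHS](big_cat_nat _ _ (n := (2 ^ s).+1)) //=.
  exact: leq_addl.
by rewrite ltnS leq_exp2l.
Qed.

(** Here [1684 = 4 * 420 + 2 + 2]. By Chebyshev, a rich cell contributes at most
    [2 / j <= 4 / (j + 1)]; the other cells below [L] contribute at most [2 / L] each, and the top
    cell at most 2. *)
Lemma rich_sum X : (X < 2 ^ L.+1)%N ->
  1684 <= \sum_(1 <= p < X.+1 | p \in Q) p%:R^-1 :> R ->
  420 <= \sum_(1 <= s < L.+1 | rich s) s%:R^-1 :> R.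
Proof.
move=> XL sumQ.
have L0 : 0 < L%:R :> R.
  by rewrite ltr0n (leq_trans _ U_le_L) // (leq_trans _ U_ge100).
pose f p : R := if p \in Q then p%:R^-1 else 0.
have f0 p : 0 <= f p by rewrite /f; case: ifP; rewrite ?invr_ge0.
have cells : \sum_(1 <= p < X.+1 | p \in Q) p%:R^-1 <=
    \sum_(j < L.+1) (cell j)%:R / (2 ^ j)%:R :> R.
  rewrite big_mkcond -/f.
  apply: (@le_trans _ _ (\sum_(1 <= p < (2 ^ L.+1).+1) f p)).
    rewrite [leRHS](big_cat_nat _ _ (n := X.+1)) //=; last by rewrite ltnS ltnW.
    by rewrite lerDl sumr_ge0.
  rewrite big_ltn ?ltnS ?expn_gt0 // {1}/f ifN ?add0r;
    last by apply/negP => /Qprime.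
  rewrite dyadic_split; apply: ler_sum => j _.
  rewrite /cell natr_sum mulr_suml /f -big_mkcond.
  rewrite big_nat_cond [leRHS]big_nat_cond.
  apply: ler_sum => p /andP[/andP[p1 _] _].
  rewrite mul1r lef_pV2 ?posrE ?ltr0n ?expn_gt0 ?(leq_trans _ p1) //.
  by rewrite ler_nat ltnW.
have bound j : (l <= j)%N -> (cell j)%:R / (2 ^ j)%:R <= 2 / j%:R :> R.
  move=> lj; have j0 : 0 < j%:R :> R by rewrite ltr0n (leq_trans l_gt0).
  rewrite ler_pdivrMr ?ltr0n ?expn_gt0 // mulrAC ler_pdivlMr // -!natrM ler_nat.
  by rewrite mulnC -expnS cell_le.
have each j : (cell j)%:R / (2 ^ j)%:R <=
    (if rich j.+1 then 4 * j.+1%:R^-1 else 0) + 2 / L%:R :> R.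
  have c0 : 0 <= 2 / L%:R :> R by rewrite divr_ge0.
  have [jl|lj] := ltnP j l.
    by rewrite cell_small // mul0r addr_ge0 //; case: ifP.
  case: ifPn => [_|]; last first.
    rewrite /rich ltnS lj /= -ltnNge add0r => lt.
    rewrite ler_pdivrMr ?ltr0n ?expn_gt0 // mulrAC ler_pdivlMr //.
    rewrite -!natrM ler_nat.
    by rewrite mulnC -expnS ltnW.
  apply: ler_wpDr => //; apply: le_trans (bound j lj) _.
  have j0 : (0 < j)%N := leq_trans l_gt0 lj.
  rewrite ler_pdivrMr ?ltr0n // mulrAC ler_pdivlMr ?ltr0n //.
  by rewrite -!natrM ler_nat; clear -j0; lia.
have total : \sum_(j < L) (cell j)%:R / (2 ^ j)%:R <=
    4 * (\sum_(1 <= s < L.+1 | rich s) s%:R^-1) + 2 :> R.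
  apply: le_trans (ler_sum _ (fun (j : 'I_L) _ => each j)) _.
  rewrite big_split /= sumr_const card_ord -[_ *+ L]mulr_natl mulrCA.
  rewrite mulfV ?gt_eqF // mulr1.
  by rewrite lerD2r big_add1 /= big_mkord mulr_sumr [leRHS]big_mkcond /=.
move: cells; rewrite big_ord_recr /=.
have : (cell L)%:R / (2 ^ L)%:R <= 2 :> R.
  apply: le_trans (bound L (leq_div _ _)) _.
  rewrite ler_pdivrMr // -[leLHS]mulr1 ler_wpM2l // ler1n.
  by rewrite (leq_trans _ U_le_L) // (leq_trans _ U_ge100).
by move: total sumQ; move: (\sum_(j < L) _) => t; lra.
Qed.

Lemma density_lower X z : (X < 2 ^ L.+1)%N ->
  1684 <= \sum_(1 <= p < X.+1 | p \in Q) p%:R^-1 :> R ->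
  (L <= 2 * z)%N -> (z <= L)%N ->
  U%:R ^- (11 * (2 * U).+1) <= density z.
Proof.
move=> XL sumQ.
apply: (level_upper_half U_ge100 U_le_L density_succ density_conv density_ge0
  density_rich); last exact: rich_sum sumQ.
by move=> s /andP[].
Qed.

(** For [m <= 2^l], the quotient [X %/ m] is rounded down to a power [2^z] with [L / 2 <= z <= L],
    where [density_lower] applies. Summing over [m] brings in [recip_sum], handled by the sieve and
    the harmonic bound. *)
Lemma smooth_count_lower X (s : seq nat) : (2 ^ L <= X < 2 ^ L.+1)%N ->
  1684 <= \sum_(1 <= p < X.+1 | p \in Q) p%:R^-1 :> R ->
  all prime s ->
  (forall p, prime p -> (p <= 2 ^ l)%N -> (p \in P) || (p \in s)) ->
  U%:R ^- (23 * U) * \prod_(p <- s) (1 - p%:R^-1) * X.+1%:R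
    <= (smooth_count X P)%:R :> R.
Proof.
move=> /andP[LX XL] sumQ ps Ps; set kap : R := U%:R ^- (11 * (2 * U).+1).
have U0 : 0 < U%:R :> R by rewrite ltr0n (leq_trans _ U_ge100).
have L0 : 0 < L%:R :> R.
  by rewrite ltr0n (leq_trans _ U_le_L) // (leq_trans _ U_ge100).
have kap0 : 0 <= kap by rewrite invr_ge0 exprn_ge0 // ltW.
have l2 : (2 * l <= L)%N.
  apply: leq_trans (leq_trunc_div L U); rewrite mulnC leq_mul2l.
  by rewrite (leq_trans _ U_ge100) ?orbT.
have each m : (0 < m)%N -> (m <= 2 ^ l)%N ->
    kap * X.+1%:R / (2 * L%:R) * m%:R^-1 <= (smooth_count (X %/ m) Q)%:R.
  move=> m0 ml; set z := trunc_log 2 (X %/ m).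
  have Xm : (2 ^ (L - l) <= X %/ m)%N.
    rewrite leq_divRL //; apply: leq_trans (leq_mul (leqnn _) ml) _.
    by rewrite -expnD subnK // (leq_trans _ l2) // leq_pmull.
  have Xm0 : (0 < X %/ m)%N by apply: leq_trans Xm; rewrite expn_gt0.
  have /andP[z1 z2] := trunc_log_bounds (isT : 1 < 2)%N Xm0.
  rewrite -/z in z1 z2.
  have zL : (z <= L)%N.
    rewrite -ltnS -(ltn_exp2l _ _ (isT : 1 < 2)%N).
    by apply: leq_ltn_trans XL; apply: leq_trans z1 (leq_div _ _).
  have Lz : (L <= 2 * z)%N.
    have : (L - l < z.+1)%N.
      by rewrite -(ltn_exp2l _ _ (isT : 1 < 2)%N); apply: leq_ltn_trans z2.
    by clear -l2; move: l l2 => k; lia.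
  have := density_lower XL sumQ Lz zL; rewrite -/kap /density => lower.
  apply: (@le_trans _ _ (smooth_count (2 ^ z) Q)%:R); last first.
    by rewrite ler_nat smooth_count_mono.
  have X1 : X.+1%:R <= 2 * m%:R * (2 ^ z)%:R :> R.
    by rewrite -!natrM ler_nat mulnAC -expnS -ltn_divLR.
  have m0' : 0 < m%:R :> R by rewrite ltr0n.
  rewrite ler_pdivrMr // ler_pdivrMr ?mulr_gt0 //.
  move: lower; rewrite ler_pdivlMr ?ltr0n ?expn_gt0 // => lower.
  apply: le_trans (ler_wpM2l kap0 X1) _; rewrite mulrCA.
  rewrite [leRHS](_ : _ = 2 * m%:R * (L%:R * (smooth_count (2 ^ z) Q)%:R));
    last by ring.
  by rewrite ler_wpM2l // ltW ?mulr_gt0.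
pose c : R := kap * X.+1%:R / (2 * L%:R).
have c0 : 0 <= c by rewrite divr_ge0 ?mulr_ge0.
have prod0 : 0 <= \prod_(p <- s) (1 - p%:R^-1) :> R.
  rewrite big_seq prodr_ge0 // => p /(allP ps) pp.
  by rewrite subr_ge0 invf_le1 ?ler1n ?ltr0n ?prime_gt0.
have sumP : c * recip_sum R (2 ^ l) P <= (smooth_count X P)%:R.
  apply: (@le_trans _ _
    (\sum_(1 <= m < (2 ^ l).+1 | P.-nat m) smooth_count (X %/ m) Q)%:R).
    rewrite /recip_sum mulr_sumr [leRHS]natr_sum.
    rewrite [leLHS]big_nat_cond [leRHS]big_nat_cond.
    by apply: ler_sum => m /andP[/andP[m0 ml] _]; apply: each.
  by rewrite ler_nat smooth_count_split.
have harm := le_trans (ler_wpM2l prod0 (harmonic_ge R l))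
  (recip_sum_sieve R ps Ps).
apply: le_trans (le_trans (ler_wpM2l c0 harm) sumP).
have lU : L%:R <= 2 * U%:R * l%:R :> R.
  have : (L < l.+1 * U)%N by rewrite ltn_ceil // (leq_trans _ U_ge100).
  by rewrite -!natrM ler_nat; move: l l_gt0 => k; clear; nia.
(* The loss [8 U] comes from [l / (4 L) >= 1 / (8 U)]; the exponents fit since
   [11 * (2 U + 1) + 2 <= 23 U]. *)
have kapU : U%:R ^- (23 * U) * (8 * U%:R) <= kap.
  rewrite mulrC ler_pdivrMr ?exprn_gt0 // /kap [leRHS]mulrC.
  rewrite ler_pdivlMr ?exprn_gt0 //.
  rewrite mulrAC -mulrA -exprSr.
  apply: (@le_trans _ _ (U%:R ^+ (11 * (2 * U).+1).+2)).
    rewrite [leRHS]exprS ler_wpM2r ?exprn_ge0 // ler_nat.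
    exact: leq_trans U_ge100.
  rewrite ler_weXn2l ?ler1n ?(leq_trans _ U_ge100) //.
  by clear -U_ge100; lia.
rewrite [leRHS](_ : _ = kap * (l%:R / (4 * L%:R)) *
  (\prod_(p <- s) (1 - p%:R^-1) * X.+1%:R)).
  rewrite -mulrA ler_wpM2r ?mulr_ge0 //.
  apply: le_trans (_ : kap * (8 * U%:R)^-1 <= _).
    by rewrite ler_pdivlMr // mulr_gt0.
  rewrite ler_wpM2l // ler_pdivlMr ?mulr_gt0 // mulrC ler_pdivrMr ?mulr_gt0 //.
  by move: lU; lra.
by rewrite /c; field; rewrite gt_eqF.
Qed.
End Cells.

(** * Reduction to powers of two *)

Lemma expR1_le4 (R : realType) : expR 1 <= 4 :> R.
Proof.
have h : 2^-1 <= expR (- 2^-1) :> R by have := expR_ge1Dx (- 2^-1 : R); lra.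
have e1 : expR (2^-1) * expR (- 2^-1) = 1 :> R by rewrite -expRD subrr expR0.
have e2 : expR 1 = expR 2^-1 * expR 2^-1 :> R.
  by rewrite -expRD; congr expR; field.
have := expR_gt0 (2^-1 : R); rewrite e2; nra.
Qed.

(** From [ln (1 / v) <= 1 / v - 1] follows [v * ln v >= v - 1 >= -1]. *)
Lemma powR_self_ge (R : realType) (v c : R) : 0 < v -> 0 <= c ->
  expR (- c) <= v `^ (c * v).
Proof.
move=> v0 c0; rewrite /powR gt_eqF // ler_expR -mulrA -[leLHS]mulrN1.
rewrite ler_wpM2l //.
have w0 : 0 < v^-1 by rewrite invr_gt0.
have : ln (1 + (v^-1 - 1)) <= v^-1 - 1.
  by apply: le_ln1Dx; rewrite ltrBrDl subrr.
rewrite addrC subrK lnV ?posrE // lerNl opprB => h.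
have := ler_wpM2l (ltW v0) h; rewrite mulrBr mulr1 mulfV ?gt_eqF //; lra.
Qed.

Lemma truncn_pow2 (R : realType) (x : R) : 2 <= x ->
  let L := trunc_log 2 (Num.truncn x) in
  [/\ (2 ^ L <= Num.truncn x < 2 ^ L.+1)%N, (2 ^ L)%:R <= x & ln x <= L.+1%:R].
Proof.
move=> x2 L; have x0 : 0 < x by apply: lt_le_trans x2.
have X1 : (0 < Num.truncn x)%N by rewrite truncn_gt0; lra.
have LX := trunc_log_bounds (isT : 1 < 2)%N X1; rewrite -/L in LX.
have /andP[L1 L2] := LX; split=> //.
  by rewrite -truncn_ge_nat // ltW.
rewrite -[leRHS]expRK ler_ln ?posrE ?expR_gt0 //.
apply: (@le_trans _ _ (2 ^ L.+1)%:R).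
  by rewrite ltW // -truncn_lt_nat // ltW.
rewrite -[L.+1%:R]mulr1 expRM_natl natrX lerXn2r ?nnegrE ?expR_ge0 //.
by have := expR_ge1Dx (1 : R); lra.
Qed.

Section Reduction.
Variables (R : realType) (x v : R) (P : nat_pred).
Hypotheses (x2 : 2 <= x) (v0 : 0 < v) (vx : v <= Num.sqrt (ln x) / 1000%:R).
Hypothesis (Px : forall p : nat, p \in P -> prime p /\ p%:R <= x).
Hypothesis sumP : 1684 <=
  \sum_(1 <= p < (Num.truncn x).+1
        | (p \in P) && (x `^ (1 / (expR 1 * v)) < p%:R)) p%:R^-1 :> R.

Let U := (Num.truncn (expR 1 * v) + 101)%N.
Let X := Num.truncn x.
Let L := trunc_log 2 X.

Let ev0 : 0 < expR 1 * v. Proof. by rewrite mulr_gt0 ?expR_gt0. Qed.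

(** Otherwise [x^(1/(ev)) >= x], and the sum in the hypothesis would be empty. *)
Lemma expv_ge1 : 1 <= expR 1 * v.
Proof.
rewrite leNgt; apply/negP => ev1; move: sumP.
rewrite big_nat_cond big1 ?lern0 // => p /andP[/andP[_ pX] /andP[_ xp]].
exfalso; move: xp; apply/negP; rewrite -leNgt.
apply: (@le_trans _ _ x).
  by rewrite -truncn_ge_nat ?(le_trans _ x2) //.
apply: le1r_powR; last by rewrite div1r invf_ge1 // ltW.
by apply: le_trans x2; rewrite ler1n.
Qed.

(** With [r] the square root of [ln x], [1 <= ev <= 4 r / 1000] forces [r >= 250], so
    [ev + 101 < r^2 <= L + 1]. *)
Lemma U_le_L : (U <= L)%N.
Proof.
have [_ _ lnx] := truncn_pow2 x2; rewrite -/X -/L in lnx.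
set r := Num.sqrt (ln x); have vr : v <= r / 1000%:R := vx.
have r0 : 0 <= r by apply: sqrtr_ge0.
have rr : r ^+ 2 = ln x.
  by rewrite sqr_sqrtr // ln_ge0 // (le_trans _ x2) // ler1n.
have e4 := expR1_le4 R; have ev1 := expv_ge1.
have ev4 : expR 1 * v <= 4 * (r / 1000%:R).
  by apply: ler_pM => //; rewrite ?expR_ge0 ?ltW.
have r250 : 250%:R <= r by lra.
rewrite -ltnS -(ltr_nat R); apply: lt_le_trans lnx; rewrite -rr.
apply: (@le_lt_trans _ _ (expR 1 * v + 101%:R)).
  by rewrite natrD lerD2r truncn_le ltW.
by nra.
Qed.

Let U_ge100 : (100 <= U)%N.
Proof. by rewrite /U addnC. Qed.

Let Q : nat_pred := [pred p | (p \in P) && (2 ^ (L %/ U) < p)%N].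

(** Since [ev <= U], one has [2^(L %/ U) <= x^(1/U) <= x^(1/(ev))]. *)
Lemma large_primes p : x `^ (1 / (expR 1 * v)) < p%:R -> (2 ^ (L %/ U) < p)%N.
Proof.
rewrite -(ltr_nat R); apply: le_lt_trans; set a := (2 ^ _)%:R.
have [_ Lx _] := truncn_pow2 x2; rewrite -/X -/L in Lx.
have U0 : 0 < U%:R :> R by rewrite ltr0n (leq_trans _ U_ge100).
have x1 : 1 <= x by apply: le_trans x2; rewrite ler1n.
have -> : a = (a ^+ U) `^ (U%:R^-1).
  by rewrite -powR_mulrn // -powRrM mulfV ?gt_eqF // powRr1.
apply: (@le_trans _ _ (x `^ (U%:R^-1))).
  apply: ge0_ler_powR.
  - by rewrite invr_ge0.
  - by rewrite nnegrE exprn_ge0.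
  - by rewrite nnegrE (le_trans _ x1).
  apply: le_trans Lx; rewrite -natrX ler_nat -expnM leq_exp2l //.
  exact: leq_trunc_div.
apply: ler_powR => //; rewrite div1r lef_pV2 ?posrE //.
apply: le_trans (ltW (truncnS_gt _)) _.
by rewrite ler_nat /U addnS ltnS leq_addr.
Qed.

Lemma Psi_lower :
  U%:R ^- (23 * U) *
    \prod_(1 <= p < X.+1 | p \in excluded_primes x P) (1 - p%:R^-1)
    <= (Psi x P)%:R / x.
Proof.
have [LX _ _] := truncn_pow2 x2; rewrite -/X -/L in LX.
have x0 : 0 < x by apply: lt_le_trans x2.
pose s := [seq p <- index_iota 1 X.+1 | p \in excluded_primes x P].
rewrite ler_pdivlMr // -big_filter -/s.
have sP p : (p \in s) = [&& prime p, p%:R <= x & p \notin P].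
  rewrite mem_filter mem_index_iota; apply: andb_idr => /and3P[pp px _].
  by rewrite prime_gt0 // ltnS truncn_ge_nat // ltW.
have prod0 : 0 <= \prod_(p <- s) (1 - p%:R^-1) :> R.
  rewrite big_seq prodr_ge0 // => p; rewrite sP => /and3P[pp _ _].
  by rewrite subr_ge0 invf_le1 ?ler1n ?ltr0n ?prime_gt0.
(* Passing from [x] to [X.+1] is safe because [x < X.+1]. *)
apply: (@le_trans _ _
  (U%:R ^- (23 * U) * \prod_(p <- s) (1 - p%:R^-1) * X.+1%:R)).
  by rewrite ler_wpM2l ?mulr_ge0 ?invr_ge0 ?exprn_ge0 // ltW // truncnS_gt.
apply: (@smooth_count_lower R P Q U L U_ge100 U_le_L _ _ X s LX) => //.
- by move=> p /Px[].
- apply: le_trans sumP _; rewrite big_mkcond [leRHS]big_mkcond.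
  apply: ler_sum => p _; rewrite inE.
  case: (p \in P) => //=; case: ifP => [/large_primes ->//|_].
  by case: ifP => // _; rewrite invr_ge0.
- by apply/allP => p; rewrite sP => /and3P[].
move=> p pp pl; rewrite sP pp; case: (p \in P) => //=; rewrite andbT.
rewrite -truncn_ge_nat ?ltW // (leq_trans pl) //.
have /andP[LX1 _] := LX; apply: leq_trans LX1.
by rewrite leq_exp2l // leq_div.
Qed.

(* [C], [B] and [K] are variables, not numerals, lest [//] compute with them in
   unary. *)
Lemma U_pow_le (C B K : nat) :
  (230 <= C)%N -> (505 <= B)%N -> (23 * B <= K)%N ->
  expR (- C%:R) / B%:R ^+ K / v `^ (C%:R * v) <= U%:R ^- (23 * U).
Proof.
move=> C_ge B_ge K_ge; set M := _ ^+ K; set w := _ `^ _; set e := expR _.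
have U1 : 1 <= U%:R :> R by rewrite ler1n (leq_trans _ U_ge100).
have U0 : 0 < U%:R :> R by apply: lt_le_trans U1.
have B0 : (0 < B)%N := leq_trans (isT : 0 < 505)%N B_ge.
have M1 : 1 <= M by rewrite exprn_ege1 // ler1n.
have e0 : 0 < e by apply: expR_gt0.
have e1 : e <= 1 by rewrite -expR0 ler_expR oppr_le0 ler0n.
have ew : e <= w := powR_self_ge v0 (ler0n R C).
have w0 : 0 < w by apply: lt_le_trans ew.
have M0 : 0 < M by apply: lt_le_trans M1.
set T := U%:R ^+ (23 * U); have T0 : 0 < T by rewrite exprn_gt0.
rewrite ler_pdivrMr // ler_pdivrMr // -mulrA mulrC ler_pdivlMr //.
have Uv : U%:R <= 4 * v + 101%:R.
  rewrite /U natrD lerD2r.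
  rewrite (le_trans (_ : _ <= expR 1 * v)) ?truncn_le ?(ltW ev0) //.
  by rewrite ler_wpM2r ?(ltW v0) // expR1_le4.
(* If [v >= 101], then [U <= 5 v <= v^2], so [U^(23 U) <= v^(46 * 5 v)], whence 230. If [v < 101],
   then [U < 505], and the constant [M] absorbs the power while [v^(C v) >= e^(-C)]. *)
have [v101|v101] := leP 101%:R v.
  suff Tw : T <= w by clear -Tw e1 M1 w0 e0 T0; nra.
  have v1 : 1 <= v by apply: le_trans v101; rewrite ler1n.
  have Uvv : U%:R <= v `^ 2%:R.
    by rewrite powR_mulrn ?(ltW v0) //; nra.
  rewrite /T -powR_mulrn ?(ltW U0) //.
  apply: (@le_trans _ _ ((v `^ 2%:R) `^ (23 * U)%:R)).
    by apply: ge0_ler_powR; rewrite ?nnegrE ?powR_ge0 ?ler0n.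
  rewrite -powRrM; apply: ler_powR => //.
  have C_geR : 230%:R <= C%:R :> R by rewrite ler_nat.
  by rewrite natrM; nra.
suff TM : T <= M by clear -TM ew M1 M0 T0 e0 w0; nra.
have UB : (U <= B)%N.
  by apply: leq_trans B_ge; rewrite -(ler_nat R); lra.
apply: (@le_trans _ _ (B%:R ^+ (23 * U))).
  by rewrite lerXn2r ?nnegrE ?ler0n ?ler_nat.
rewrite ler_weXn2l ?ler1n // (leq_trans _ K_ge) //.
by rewrite leq_mul2l UB orbT.
Qed.
End Reduction.

Theorem theorem1 (R : realType) :
  exists lambda c c1 C : R,
    [/\ 0 < lambda, 0 < c, 0 < c1 & 0 < C] /\
    forall (x : R) (P : nat_pred),
      2 <= x ->
      (forall p : nat, p \in P -> prime p /\ p%:R <= x) ->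
      forall v : R,
        0 < v -> v <= c * Num.sqrt (ln x) ->
        1 + lambda <=
          \sum_(1 <= p < (Num.truncn x).+1
                | (p \in P) && (x `^ (1 / (expR 1 * v)) < p%:R)) p%:R^-1 ->
        c1 / (v `^ (C * v)) *
          \prod_(1 <= p < (Num.truncn x).+1 | p \in excluded_primes x P)
            (1 - p%:R^-1)
        <= (Psi x P)%:R / x.
Proof.
have [C C_ge] : exists C, (230 <= C)%N by exists 230%N.
have [B B_ge] : exists B, (505 <= B)%N by exists 505%N.
have [K K_ge] : exists K, (23 * B <= K)%N by exists (23 * B)%N.
have B0 : (0 < B)%N := leq_trans (isT : 0 < 505)%N B_ge.
have C0 : (0 < C)%N := leq_trans (isT : 0 < 230)%N C_ge.
(* The first witness makes [1 + lambda] equal to the threshold 1684 of [rich_sum]. *)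
exists 1683%:R, (1000%:R^-1), (expR (- C%:R) / B%:R ^+ K), C%:R.
split.
  by split; rewrite ?ltr0n ?invr_gt0 ?divr_gt0 ?expR_gt0 ?exprn_gt0 ?ltr0n.
move=> x P x2 Px v v0; rewrite mulrC => vx; rewrite nat1r => sumP.
apply: le_trans (Psi_lower x2 v0 vx Px sumP).
apply: ler_wpM2r (U_pow_le v0 C_ge B_ge K_ge).
rewrite prodr_ge0 // => p /and3P[pp _ _].
by rewrite subr_ge0 invf_le1 ?ler1n ?ltr0n ?prime_gt0.
Qed.
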